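(* Let $D$ be a class-balanced training set of $N$ points with $C$ classes (each class has $N/C$ points), sorted by distance to the validation point, with weights in the $b$-bit grid $\mathbf W$, $W=2^b$, and $K\ge2$. Then the exact Shapley values $\{\phi_{z_i}(\widetilde v)\}_{z_i\in D}$ with respect to the utility $\widetilde v$ can be computed with total running time $O\!\left(\frac{K^2N^2W}{C}\right)$.
   Context: $D=\{z_1,\dots,z_N\}$, $z_i=(x_i,y_i)$, labels in $\{1,\dots,C\}$, validation point $z^{(\mathrm{val})}=(x^{(\mathrm{val})},y^{(\mathrm{val})})$, indexed so that $d(x_1,x^{(\mathrm{val})})\le\cdots\le d(x_N,x^{(\mathrm{val})})$; weights $w_j\in\mathbf W$, where $\mathbf W$ is the set of $2^b$ equally spaced points of $[0,1]$. For $S\subseteq D$, $\alpha(S,j)$ is the $j$-th smallest index of a point in $S$. For a class $c\ne y^{(\mathrm{val})}$, let $S^{(c)}=\{(x,y)\in S: y\in\{y^{(\mathrm{val})},c\}\}$ and $v^{(c)}(S)=\mathbb 1\big[\sum_{j=1}^{\min(K,|S^{(c)}|)}w_{\alpha(S^{(c)},j)}\mathbb 1[y_{\alpha(S^{(c)},j)}=y^{(\mathrm{val})}]\ge\sum_{j=1}^{\min(K,|S^{(c)}|)}w_{\alpha(S^{(c)},j)}\mathbb 1[y_{\alpha(S^{(c)},j)}=c]\big]$, and $\widetilde v(S)=\frac1{C-1}\sum_{c\in[C]\setminus\{y^{(\mathrm{val})}\}}v^{(c)}(S)$. Shapley value $\phi_z(u)=\frac1N\sum_{k=1}^N\binom{N-1}{k-1}^{-1}\sum_{S\subseteq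 D\setminus\{z\},|S|=k-1}[u(S\cup\{z\})-u(S)]$. *)

(* Defs.v *)
From HB Require Import structures.
From mathcomp Require Import all_boot all_order all_algebra.
Set Implicit Arguments.
Unset Strict Implicit.
Unset Printing Implicit Defensive.
Import Order.TTheory GRing.Theory Num.Theory.
Local Open Scope ring_scope.

(** * Weighted nearest-neighbour utility and Shapley value

    The training points are identified with their indices 'I_N, so that
    S \subseteq D is a {set 'I_N}; the labels {1, ..., C} are 'I_C. *)

Section Utility.
Variables (N C K : nat).
Variables (y : 'I_N -> 'I_C) (yval : 'I_C) (w : 'I_N -> rat).

(* The enumeration of a set of ordinals is increasing, so this is the index
   of rank j (ranks counted from 0). *)
Definition alpha (S : {set 'I_N}) (j : 'I_#|S|) : 'I_N := enum_val j.

Definition restrict_class (c : 'I_C) (S : {set 'I_N}) : {set 'I_N} :=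
  [set i in S | (y i == yval) || (y i == c)].

(* The total weight of the points with label a among the min(K, |S|) points
   of S of least index. *)
Definition vote (S : {set 'I_N}) (a : 'I_C) : rat :=
  \sum_(j < minn K #|S|)
     let i := alpha (widen_ord (geq_minr K #|S|) j) in w i * (y i == a)%:R.

Definition class_utility (c : 'I_C) (S : {set 'I_N}) : rat :=
  let Sc := restrict_class c S in (vote Sc yval >= vote Sc c)%R%:R.

Definition utility (S : {set 'I_N}) : rat :=
  (C%:R - 1)^-1 * \sum_(c : 'I_C | c != yval) class_utility c S.

End Utility.

Definition shapley (N : nat) (u : {set 'I_N} -> rat) (i : 'I_N) : rat :=
  N%:R^-1 * \sum_(1 <= k < N.+1)
    ('C(N.-1, k.-1))%:R^-1 *
    \sum_(S : {set 'I_N} | (i \notin S) && (#|S| == k.-1)) (u (i |: S) - u S).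

Definition class_balanced (N C : nat) (y : 'I_N -> 'I_C) : Prop :=
  forall c : 'I_C, #|[set i | y i == c]|%:R = N%:R / C%:R :> rat.

(* The 2^b equally spaced points 0 = 0/(2^b-1), ..., (2^b-1)/(2^b-1) = 1. *)
Definition weight_grid (b : nat) : seq rat :=
  [seq k%:R / (2 ^ b - 1)%:R | k <- iota 0 (2 ^ b)].

(** * Model of computation

    A random access machine with arithmetic at unit cost, presented as a small
    imperative language with explicit costs. There are two kinds of data:
    natural numbers (counters, labels and addresses) and rationals. Memory
    consists of arrays named by naturals that occur literally in the program;
    a scalar variable is a cell of an array. Naturals only have addition and
    truncated subtraction, rationals only have the field operations and
    comparison. As is usual at unit cost, a rational cannot be rounded to a
    natural; a natural can be converted to a rational. Every syntax node costs
    one unit each time it is evaluated. *)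

Record state := State {
  nat_mem : nat -> nat -> nat;   (* array, cell *)
  rat_mem : nat -> nat -> rat }.

Inductive nexp :=
| NConst of nat
| NGet of nat & nexp           (* array name, address *)
| NAdd of nexp & nexp
| NSub of nexp & nexp.

Inductive qexp :=
| QConst of rat
| QGet of nat & nexp
| QNat of nexp
| QAdd of qexp & qexp
| QSub of qexp & qexp
| QMul of qexp & qexp
| QDiv of qexp & qexp.

Inductive bexp :=
| BNLe of nexp & nexp
| BQLe of qexp & qexp
| BNot of bexp
| BAnd of bexp & bexp.

Inductive cmd :=
| Skip
| NSet of nat & nexp & nexp    (* array name, address, value *)
| QSet of nat & nexp & qexp
| Seq of cmd & cmd
| If of bexp & cmd & cmd
| While of bexp & cmd.

Fixpoint neval (s : state) (e : nexp) : nat :=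
  match e with
  | NConst n => n
  | NGet a e1 => nat_mem s a (neval s e1)
  | NAdd e1 e2 => (neval s e1 + neval s e2)%N
  | NSub e1 e2 => (neval s e1 - neval s e2)%N
  end.

Fixpoint qeval (s : state) (e : qexp) : rat :=
  match e with
  | QConst q => q
  | QGet a e1 => rat_mem s a (neval s e1)
  | QNat e1 => (neval s e1)%:R
  | QAdd e1 e2 => qeval s e1 + qeval s e2
  | QSub e1 e2 => qeval s e1 - qeval s e2
  | QMul e1 e2 => qeval s e1 * qeval s e2
  | QDiv e1 e2 => qeval s e1 / qeval s e2
  end.

Fixpoint beval (s : state) (e : bexp) : bool :=
  match e with
  | BNLe e1 e2 => (neval s e1 <= neval s e2)%N
  | BQLe e1 e2 => qeval s e1 <= qeval s e2
  | BNot e1 => ~~ beval s e1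
  | BAnd e1 e2 => beval s e1 && beval s e2
  end.

Fixpoint ncost (e : nexp) : nat :=
  match e with
  | NConst _ => 1
  | NGet _ e1 => (ncost e1).+1
  | NAdd e1 e2 | NSub e1 e2 => (ncost e1 + ncost e2).+1
  end.

Fixpoint qcost (e : qexp) : nat :=
  match e with
  | QConst _ => 1
  | QGet _ e1 | QNat e1 => (ncost e1).+1
  | QAdd e1 e2 | QSub e1 e2 | QMul e1 e2 | QDiv e1 e2 =>
      (qcost e1 + qcost e2).+1
  end.

Fixpoint bcost (e : bexp) : nat :=
  match e with
  | BNLe e1 e2 => (ncost e1 + ncost e2).+1
  | BQLe e1 e2 => (qcost e1 + qcost e2).+1
  | BNot e1 => (bcost e1).+1
  | BAnd e1 e2 => (bcost e1 + bcost e2).+1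
  end.

Definition store (T : Type) (m : nat -> nat -> T) (a i : nat) (x : T) :
    nat -> nat -> T :=
  fun a' i' => if (a' == a) && (i' == i) then x else m a' i'.

Definition nset (s : state) (a i n : nat) : state :=
  State (store (nat_mem s) a i n) (rat_mem s).

Definition qset (s : state) (a i : nat) (q : rat) : state :=
  State (nat_mem s) (store (rat_mem s) a i q).

(* exec p s t s': run from s, the program p halts in s' after t units of time.
   A diverging run is related to no t and s'. *)
Inductive exec : cmd -> state -> nat -> state -> Prop :=
| ExecSkip s : exec Skip s 1 s
| ExecNSet s a e1 e2 :
    exec (NSet a e1 e2) s (ncost e1 + ncost e2).+1
      (nset s a (neval s e1) (neval s e2))
| ExecQSet s a e1 e2 :
    exec (QSet a e1 e2) s (ncost e1 + qcost e2).+1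
      (qset s a (neval s e1) (qeval s e2))
| ExecSeq p1 p2 s1 s2 s3 t1 t2 :
    exec p1 s1 t1 s2 -> exec p2 s2 t2 s3 ->
    exec (Seq p1 p2) s1 (t1 + t2).+1 s3
| ExecIf e p1 p2 s s' t :
    exec (if beval s e then p1 else p2) s t s' ->
    exec (If e p1 p2) s (bcost e + t).+1 s'
| ExecWhileEnd e p s :
    ~~ beval s e -> exec (While e p) s (bcost e).+1 s
| ExecWhileStep e p s1 s2 s3 t1 t2 :
    beval s1 e -> exec p s1 t1 s2 -> exec (While e p) s2 t2 s3 ->
    exec (While e p) s1 (bcost e + t1 + t2).+1 s3.

Lemma exec_det p s t1 s1 t2 s2 :
  exec p s t1 s1 -> exec p s t2 s2 -> t1 = t2 /\ s1 = s2.
Proof.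
move=> ex1; elim: ex1 t2 s2 => {p s t1 s1}.
- by move=> s t2 s2 ex2; inversion ex2.
- by move=> s a e1 e2 t s2 ex2; inversion ex2.
- by move=> s a e1 e2 t s2 ex2; inversion ex2.
- move=> p1 p2 s1 s2 s3 t1 t2 _ IH1 _ IH2 t s4 ex2.
  inversion ex2 as [| | |q1 q2 r1 r2 r3 v1 v2 E1 E2| | |]; subst.
  have [? ?] := IH1 _ _ E1; subst.
  by have [? ?] := IH2 _ _ E2; subst.
- move=> e p1 p2 s s' t _ IH t2 s2 ex2.
  inversion ex2 as [| | | |e' q1 q2 r r' v E| |]; subst.
  by have [? ?] := IH _ _ E; subst.
- move=> e p s ne t s2 ex2.
  inversion ex2 as [| | | | |e' q r E|e' q r1 r2 r3 v1 v2 E E1 E2]; subst => //.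
  by rewrite E in ne.
- move=> e p s1 s2 s3 t1 t2 be _ IH1 _ IH2 t s4 ex2.
  inversion ex2 as [| | | | |e' q r E|e' q r1 r2 r3 v1 v2 E E1 E2]; subst.
    by rewrite be in E.
  have [? ?] := IH1 _ _ E1; subst.
  by have [? ?] := IH2 _ _ E2; subst.
Qed.

(* Cell i of array a is the entry of rank i of the sequence of rank a; all
   the other cells are 0. *)
Definition load (T : nmodType) (arrays : seq (seq T)) : nat -> nat -> T :=
  fun a i => nth 0 (nth [::] arrays a) i.

(* Natural array 0 holds the parameters, natural array 1 the labels and
   rational array 0 the weights, the points being listed in index order. *)
Definition input (N C K b : nat) (y : 'I_N -> 'I_C) (yval : 'I_C)
    (w : 'I_N -> rat) : state :=
  State
    (load [:: [:: N; C; K; b; nat_of_ord yval];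
              [seq nat_of_ord (y i) | i <- enum 'I_N]])
    (load [:: [seq w i | i <- enum 'I_N]]).

Definition output (s : state) (i : nat) : rat := rat_mem s 1 i.

(* Main.v *)
Require Import Defs.
From mathcomp Require Import all_boot all_order all_algebra.
From mathcomp Require Import zify ring.
Set Implicit Arguments.
Unset Strict Implicit.
Unset Printing Implicit Defensive.
Import Order.TTheory GRing.Theory Num.Theory.
Local Open Scope ring_scope.

(* Let D_c be the set of the points labelled yval or c, of size n = 2N/C. Only the K points of least
   index of a coalition within D_c matter. Conditioning the Shapley distribution on the trace of
   the coalition on a set B gives the Shapley distribution of a game with |B| + 1 players.
   Hence the value of i for v^(c) is a sum over coalitions T in D_c \ {i} with |T| < K, plus, for
   each m > i in D_c, a sum over the T of size K - 1 among the points before m: there m is the K-th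
   point of the coalition and i replaces it. Both sums depend on T only through its size and the
   sum of its integer votes, so the coalitions are counted by a knapsack recursion with a table
   of size O(K^2 W). For each c and each i in D_c, all points of D_c are inserted into the table,
   which takes O(C n^2 K^2 W) = O(K^2 N^2 W / C) steps. To find the sets D_c within this bound,
   the points are first distributed into linked lists by label, which are merged pairwise. *)

(** * A program logic for time-bounded total correctness *)

(** The time bound shapes the program in several places. Scanning all points for each class would
    cost C * N, which exceeds K^2 * N^2 * W / C when, for instance, N = C is large compared with K^2
    * W; hence the linked lists. The integer votes are found by a search of up to W steps per point;
    the total N * W is admissible because N >= C. The shifted votes of at most K points add up to at
    most K * 2 * (W - 1), so a layer of the table gets 2 * K * W cells, and the K possible sizes
    below K give K layers. Inserting the points in index order makes the table count, when [m] is
    reached, exactly the coalitions among the points before [m], so that one pass serves every [m].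
    The table is started anew for each [i], since [i] itself must be left out of it. *)

Fixpoint csize (c : cmd) : nat :=
  match c with
  | Skip => 1
  | NSet _ e1 e2 => (ncost e1 + ncost e2).+1
  | QSet _ e1 e2 => (ncost e1 + qcost e2).+1
  | Seq c1 c2 => (csize c1 + csize c2).+1
  | If e c1 c2 => (bcost e + csize c1 + csize c2).+1
  | While e c1 => (bcost e + csize c1).+1
  end.

Fixpoint nwrites (c : cmd) : seq nat :=
  match c with
  | NSet a _ _ => [:: a]
  | Seq c1 c2 | If _ c1 c2 => nwrites c1 ++ nwrites c2
  | While _ c1 => nwrites c1
  | _ => [::]
  end.

Fixpoint qwrites (c : cmd) : seq nat :=
  match c with
  | QSet a _ _ => [:: a]
  | Seq c1 c2 | If _ c1 c2 => qwrites c1 ++ qwrites c2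
  | While _ c1 => qwrites c1
  | _ => [::]
  end.

(** Frame condition. [exec_agree] provides it for every run, so that loop invariants need to speak
    only of the cells that the loop changes. *)
Definition agree (ns qs : seq nat) (s s' : state) : Prop :=
  (forall a i, a \notin ns -> nat_mem s' a i = nat_mem s a i) /\
  (forall a i, a \notin qs -> rat_mem s' a i = rat_mem s a i).

Lemma agree_refl ns qs s : agree ns qs s s.
Proof. by []. Qed.

Lemma agree_trans ns qs s1 s2 s3 :
  agree ns qs s1 s2 -> agree ns qs s2 s3 -> agree ns qs s1 s3.
Proof.
by move=> [n12 q12] [n23 q23]; split=> a i ia; [rewrite n23 ?n12|rewrite q23 ?q12].
Qed.

Lemma agree_sub ns qs ns' qs' s s' :
  {subset ns <= ns'} -> {subset qs <= qs'} -> agree ns qs s s' -> agree ns' qs' s s'.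
Proof.
by move=> sn sq [n q]; split=> a i ia; [apply: n|apply: q]; apply: contra ia;
  [apply: sn|apply: sq].
Qed.

Lemma agree_all ns qs ns' qs' s s' : agree ns qs s s' ->
  all [in ns'] ns -> all [in qs'] qs -> agree ns' qs' s s'.
Proof. by move=> a /allP n /allP q; apply: agree_sub a. Qed.

Lemma agree_nset ns qs s a i n : a \in ns -> agree ns qs s (nset s a i n).
Proof.
move=> ia; split=> // a' i' /=; rewrite /store; case: eqP => // ->; by rewrite ia.
Qed.

Lemma agree_qset ns qs s a i q : a \in qs -> agree ns qs s (qset s a i q).
Proof.
move=> ia; split=> // a' i' /=; rewrite /store; case: eqP => // ->; by rewrite ia.
Qed.

Lemma exec_agree c s t s' : exec c s t s' -> agree (nwrites c) (qwrites c) s s'.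
Proof.
elim=> {c s t s'} //=.
- by move=> s a e1 e2; apply: agree_nset; rewrite inE.
- by move=> s a e1 e2; apply: agree_qset; rewrite inE.
- move=> c1 c2 s1 s2 s3 t1 t2 _ IH1 _ IH2.
  by apply: agree_trans; [apply: agree_sub IH1|apply: agree_sub IH2] => x xi;
    rewrite mem_cat xi ?orbT.
- move=> e c1 c2 s s' t _; case: ifP => _; apply: agree_sub => x xi;
    by rewrite mem_cat xi ?orbT.
- by move=> e c s1 s2 s3 t1 t2 _ _ IH1 _ IH2; apply: agree_trans IH1 IH2.
Qed.

(* The running time is measured in multiples of the size of the program text, so that
   only the numbers of iterations of the loops have to be multiplied up. *)
Definition wp (c : cmd) (s : state) (X : nat) (Q : state -> Prop) : Prop :=
  exists t s', [/\ exec c s t s', (t <= csize c * X)%N & Q s'].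

Lemma wp_conseq c s X X' (Q Q' : state -> Prop) :
  wp c s X Q -> (X <= X')%N ->
  (forall s', agree (nwrites c) (qwrites c) s s' -> Q s' -> Q' s') -> wp c s X' Q'.
Proof.
move=> [t [s' [ex tX q]]] XX' QQ'; exists t, s'; split=> //.
  by apply: leq_trans tX _; rewrite leq_mul2l XX' orbT.
by apply: QQ' => //; apply: exec_agree ex.
Qed.

Lemma wp_skip s X (Q : state -> Prop) : (0 < X)%N -> Q s -> wp Skip s X Q.
Proof. by move=> X0 q; exists 1%N, s; split=> //=; [exact: ExecSkip|rewrite mul1n]. Qed.

Lemma wp_nset a e1 e2 s X (Q : state -> Prop) :
  (0 < X)%N -> Q (nset s a (neval s e1) (neval s e2)) -> wp (NSet a e1 e2) s X Q.
Proof.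
by move=> X0 q; do 2!eexists; split; [exact: ExecNSet|rewrite /= leq_pmulr|].
Qed.

Lemma wp_qset a e1 e2 s X (Q : state -> Prop) :
  (0 < X)%N -> Q (qset s a (neval s e1) (qeval s e2)) -> wp (QSet a e1 e2) s X Q.
Proof.
by move=> X0 q; do 2!eexists; split; [exact: ExecQSet|rewrite /= leq_pmulr|].
Qed.

(** Both commands get the same budget [X] rather than a share of it: their sizes already add up in
    [csize], and [0 < X] pays for the [Seq] node. *)
Lemma wp_seq c1 c2 s X (Q : state -> Prop) :
  (0 < X)%N -> wp c1 s X (fun s' => wp c2 s' X Q) -> wp (Seq c1 c2) s X Q.
Proof.
move=> X0 [t1 [s1 [ex1 tX1 [t2 [s2 [ex2 tX2 q]]]]]].
exists (t1 + t2).+1, s2; split=> //; first exact: ExecSeq ex1 ex2.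
rewrite /= mulSn mulnDl; lia.
Qed.

Lemma wp_if e c1 c2 s X (Q : state -> Prop) :
  (0 < X)%N -> (beval s e -> wp c1 s X Q) -> (~~ beval s e -> wp c2 s X Q) ->
  wp (If e c1 c2) s X Q.
Proof.
move=> X0 H1 H2.
have [t [s' [ex tX q]]] : exists t s', [/\ exec (if beval s e then c1 else c2) s t s',
    (t <= (csize c1 + csize c2) * X)%N & Q s'].
  case: ifP => be.
    have [t [s' [ex tX q]]] := H1 be; exists t, s'; split=> //.
    by rewrite mulnDl; lia.
  have [t [s' [ex tX q]]] := H2 (negbT be); exists t, s'; split=> //.
  by rewrite mulnDl; lia.
exists (bcost e + t).+1, s'; split=> //; first exact: ExecIf.
have := leq_pmulr (bcost e) X0; rewrite /= mulSn -addnA mulnDl; lia.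
Qed.

(** The index of [I] counts the rounds done so far; [n.+1] stands for at most [n] rounds and the
    final failing test. *)
Lemma wp_while e c s X n (I : nat -> state -> Prop) (Q : state -> Prop) :
  (0 < X)%N -> I 0%N s ->
  (forall k s', agree (nwrites c) (qwrites c) s s' -> I k s' -> beval s' e ->
     (k < n)%N /\ wp c s' X (I k.+1)) ->
  (forall k s', agree (nwrites c) (qwrites c) s s' -> I k s' -> ~~ beval s' e -> Q s') ->
  wp (While e c) s (n.+1 * X)%N Q.
Proof.
move=> X0 I0 Hc HQ.
suff H m k s1 : agree (nwrites c) (qwrites c) s s1 -> I k s1 -> (n - k = m)%N ->
    wp (While e c) s1 (m.+1 * X)%N Q.
  by apply: (H _ 0%N) => //; rewrite subn0.
elim: m k s1 => [|m IH] k s1 a1 I1 nk; case be: (beval s1 e);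
  try by [have [kn _] := Hc _ _ a1 I1 be; lia];
  try by [exists (bcost e).+1, s1; split;
    [apply: ExecWhileEnd; rewrite be
    |rewrite /= ; apply: leq_trans (leq_pmulr _ _); [lia|rewrite muln_gt0]
    |apply: (HQ k) => //; rewrite be]].
have [kn [t1 [s2 [ex1 tX1 I2]]]] := Hc _ _ a1 I1 be.
have [||t2 [s3 [ex2 tX2 q]]] := IH k.+1 s2 _ I2; first last.
  exists (bcost e + t1 + t2).+1, s3; split=> //; first exact: ExecWhileStep ex1 ex2.
  have := leq_pmulr (bcost e) X0.
  move: tX2; rewrite /= !mulSn mulnDr mulnDl; set Z := (_ * (m * X))%N.
  move: tX1; set Y := (csize c * X)%N => tX1.
  have -> : ((bcost e + csize c) * (X + (X + m * X)) =
    bcost e * X + Y + (bcost e + csize c) * (X + m * X))%N by rewrite /Y; lia.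
  lia.
- by lia.
- exact: agree_trans a1 (exec_agree ex1).
Qed.

Definition V a := NGet a (NConst 0).

Definition For x e c :=
  Seq (NSet x (NConst 0) (NConst 0))
    (While (BNLe (NAdd (V x) (NConst 1)) e)
       (Seq c (NSet x (NConst 0) (NAdd (V x) (NConst 1))))).

Lemma wp_for x e c s X n (I : nat -> state -> Prop) (Q : state -> Prop) :
  (0 < X)%N -> x \notin nwrites c ->
  (forall s', agree (x :: nwrites c) (qwrites c) s s' -> neval s' e = n) ->
  I 0%N (nset s x 0 0) ->
  (forall k s', agree (x :: nwrites c) (qwrites c) s s' -> (k < n)%N ->
     nat_mem s' x 0 = k -> I k s' ->
     wp c s' X (fun s2 => I k.+1 (nset s2 x 0 k.+1))) ->
  (forall s', agree (x :: nwrites c) (qwrites c) s s' -> I n s' -> Q s') ->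
  wp (For x e c) s (n.+1 * X)%N Q.
Proof.
move=> X0 xc He I0 Hc HQ.
have nX0 : (0 < n.+1 * X)%N by rewrite muln_gt0.
apply: wp_seq => //; apply: wp_nset => //=.
set s0 := nset s x 0 0.
have a0 s' : agree (nwrites c ++ [:: x]) (qwrites c ++ [::]) s0 s' ->
    agree (x :: nwrites c) (qwrites c) s s'.
  move=> a; apply: agree_trans (agree_nset _ _ _ _ (mem_head _ _)) _.
  by apply: agree_sub a => z; rewrite ?cats0 // mem_cat !inE orbC.
apply: (@wp_while _ _ _ _ n (fun k s' => [/\ (k <= n)%N, nat_mem s' x 0 = k & I k s'])) => //.
- by split=> //=; rewrite /store !eqxx.
- move=> k s' /= /a0 a [kn xk Ik]; rewrite xk (He _ a) addn1 => lt_kn; split=> //.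
  apply: wp_seq => //; apply: wp_conseq (Hc k s' a lt_kn xk Ik) _ _ => // s2 a2 I2.
  have x2 : nat_mem s2 x 0 = k by rewrite a2.1.
  by apply: wp_nset => //=; rewrite x2 addn1; split=> //; rewrite /store !eqxx.
- move=> k s' /= /a0 a [kn xk Ik]; rewrite xk (He _ a) addn1 -leqNgt => le_nk.
  by apply: HQ => //; have -> : n = k by lia.
Qed.

(** * Shapley weights *)

(** For k < n this is k! (n-1-k)! / n!, the coefficient of a marginal contribution to a coalition of
    size k in a game with n players; for k >= n it is 0, as the inverse of 0. *)
Definition pweight (n k : nat) : rat := (n%:R * 'C(n.-1, k)%:R)^-1.

Lemma pweight0 n : pweight n 0 = n%:R^-1.
Proof. by rewrite /pweight bin0 mulr1. Qed.

(* For [k >= n.-1] both sides are 0, as x / 0 = 0. *)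
Lemma pweightS n k : pweight n k.+1 = pweight n k * (k.+1%:R / (n.-1 - k)%:R).
Proof.
rewrite /pweight; have := mul_bin_left n.-1 k; move: (n.-1) => m E.
case: (ltnP k m) => [km|mk]; last first.
  have -> : (m - k = 0)%N by lia.
  by rewrite bin_small ?ltnS // !(mulr0, invr0).
have mk0 : (m - k)%:R != 0 :> rat by rewrite pnatr_eq0; lia.
have k0 : k.+1%:R != 0 :> rat by rewrite pnatr_eq0.
have -> : 'C(m, k.+1)%:R = (m - k)%:R * 'C(m, k)%:R / k.+1%:R :> rat.
  by rewrite -natrM -E natrM [k.+1%:R * _]mulrC mulfK.
by rewrite !invfM invrK; ring.
Qed.

(** One of n + 1 players is forgotten: it was either absent from the coalition or a further member
    of it. *)
Lemma pweight_split n k : (k < n)%N -> pweight n.+1 k + pweight n.+1 k.+1 = pweight n k.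
Proof.
move=> kn; rewrite pweightS /=.
have nk0 : (n - k)%:R != 0 :> rat by rewrite pnatr_eq0; lia.
have n0 : n.+1%:R != 0 :> rat by rewrite pnatr_eq0.
have -> : pweight n.+1 k + pweight n.+1 k * (k.+1%:R / (n - k)%:R)
   = pweight n.+1 k * (n.+1%:R / (n - k)%:R).
  have -> : n.+1%:R = (n - k)%:R + k.+1%:R :> rat by rewrite -natrD; congr (_%:R); lia.
  by field.
have E : n%:R * 'C(n.-1, k)%:R = (n - k)%:R * 'C(n, k)%:R :> rat.
  by rewrite -!natrM mul_bin_down.
rewrite /pweight E /= !invfM.
by rewrite mulrACA mulVf // mul1r mulrC.
Qed.

Section Subsets.
Variable T : finType.
Implicit Types A B S : {set T}.

Lemma big_subsets_setU1 (R : Type) (idx : R) (op : Monoid.com_law idx) x B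
    (F : {set T} -> R) : x \notin B ->
  \big[op/idx]_(A : {set T} | A \subset x |: B) F A =
  op (\big[op/idx]_(A : {set T} | A \subset B) F A)
     (\big[op/idx]_(A : {set T} | A \subset B) F (x |: A)).
Proof.
move=> xB; rewrite (bigID (fun A => x \in A)) /= Monoid.mulmC; congr (op _ _).
  by apply: eq_bigl => A; rewrite -subsetD1 setU1K.
rewrite (reindex_onto (fun A => x |: A) (fun A => A :\ x)) /=; last first.
  by move=> A /andP[_ xA]; rewrite setD1K.
apply: eq_bigl => A; rewrite setU11 andbT.
apply/andP/idP => [[AB /eqP E]|AB].
  have xA : x \notin A by rewrite -E !inE eqxx.
  apply/subsetP => z zA; have := subsetP AB z; rewrite !inE zA orbT => /(_ isT).
  by case/orP => // /eqP zx; rewrite -zx zA in xA.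
have xA : x \notin A by apply: contra xB; apply: subsetP.
by split; [rewrite setUS|rewrite setU1K].
Qed.

(* Conditioning the Shapley distribution on the trace of the coalition on [B] gives
   the Shapley distribution of a game with [#|B|.+1] players. *)
Lemma sum_pweight_trace (i : T) B A : i \notin B -> A \subset B ->
  \sum_(S : {set T} | (i \notin S) && (S :&: B == A)) pweight #|T| #|S| =
  pweight #|B|.+1 #|A|.
Proof.
(* Induction on the number of players outside [i |: B]. One of them, [j], is moved into [B]; the
   coalitions with trace [A] on [B] then have trace [A] or [j |: A] on [j |: B], and [pweight_split]
   adds the two cases. *)
move: {2}(#|T| - #|B|.+1)%N (erefl (#|T| - #|B|.+1)%N) => d.
elim: d A B => [|d IH] A B Ed iB AB.
  have EB : i |: B = setT.
    by apply/eqP; rewrite eqEcard subsetT cardsT cardsU1 iB; lia.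
  have EN : #|T| = #|B|.+1 by rewrite -cardsT -EB cardsU1 iB.
  rewrite (bigD1 A) /=; last first.
    rewrite (contra (subsetP AB i)) //=; exact/eqP/setIidPl.
  rewrite EN big1 ?addr0 // => S /andP[/andP[iS /eqP ESB] /eqP[]].
  rewrite -ESB; apply/esym/setIidPl/subsetP => z zS.
  have : z \in i |: B by rewrite EB inE.
  by rewrite !inE; case/orP => // /eqP zi; rewrite -zi zS in iS.
have : exists j, j \notin i |: B.
  apply/existsP; rewrite -negb_forall; apply/negP => /forallP H.
  have : (#|T| <= #|i |: B|)%N by rewrite -cardsT; apply/subset_leq_card/subsetP => z _.
  by rewrite cardsU1 iB; lia.
case=> j; rewrite !inE negb_or => /andP[ji jB].
have jA : j \notin A by apply: contra jB; apply: subsetP.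
have iB' : i \notin j |: B by rewrite !inE eq_sym negb_or ji.
have lAB := subset_leq_card AB.
have cB' : #|j |: B| = #|B|.+1 by rewrite cardsU1 jB.
have cA' : #|j |: A| = #|A|.+1 by rewrite cardsU1 jA.
have dB' : (#|T| - #|j |: B|.+1 = d)%N by lia.
have := IH A _ dB' iB' (subset_trans AB (subsetUr _ _)).
have := IH (j |: A) _ dB' iB' (setUS _ AB).
rewrite cB' cA' => E2 E1; rewrite -(pweight_split (n := #|B|.+1)) ?ltnS // -E1 -E2.
rewrite (bigID (fun S => j \in S)) /= addrC; congr (_ + _); apply: eq_bigl => S;
  rewrite -andbA; congr (_ && _).
  apply/andP/eqP => [[/eqP <- jS]|E].
    by rewrite setIUr (_ : S :&: [set j] = set0) ?set0U //;
      apply/setP => z; rewrite !inE; case: eqP => [->|]; rewrite ?andbF // (negbTE jS).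
  have jS : j \notin S by apply: contra jA => jS; rewrite -E !inE jS eqxx.
  split=> //; rewrite -E; apply/eqP/setP => z; rewrite !inE.
  by case: eqP => // ->; rewrite (negbTE jS).
apply/andP/eqP => [[/eqP <- jS]|E].
  by apply/setP => z; rewrite !inE; case: eqP => [->|]; rewrite ?jS.
have jS : j \in S by have := setU11 j A; rewrite -E inE => /andP[].
split=> //; apply/eqP/setP => z; have /setP/(_ z) := E; rewrite !inE.
by case: (eqVneq z j) => // ->; rewrite (negbTE jB) (negbTE jA) andbF.
Qed.

End Subsets.

Lemma shapleyE N (u : {set 'I_N} -> rat) i :
  shapley u i = \sum_(S : {set 'I_N} | i \notin S) pweight N #|S| * (u (i |: S) - u S).
Proof.
case: N u i => [|n] u i; first by case: i.
rewrite /shapley big_add1 /= big_mkord mulr_sumr.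
(* [inord] does not distort the size, since [i \notin S] leaves at most [n] points. *)
rewrite [RHS](partition_big (fun S : {set 'I_n.+1} => inord #|S| : 'I_n.+1) predT) //=.
apply: eq_bigr => k _.
rewrite mulrA mulr_sumr; apply: eq_big => S.
  case: (boolP (i \in S)) => //= iS.
  have SN : (#|S| < n.+1)%N.
    rewrite -[X in (_ < X)%N]card_ord -cardsT proper_card // properT.
    by apply: contraNneq iS => ->; rewrite inE.
  by apply/eqP/eqP => [E|<-]; [apply: val_inj; rewrite /= inordK|rewrite inordK].
by move=> /andP[_ /eqP ->]; rewrite /pweight invfM.
Qed.

(** * Reduction to coalitions of fewer than K points *)

Section Ranks.
Variable N : nat.
Implicit Types (A X : {set 'I_N}) (i m : 'I_N).

Definition before A m : {set 'I_N} := [set j in A | (j < m)%N].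

Lemma in_before A m j : (j \in before A m) = (j \in A) && (j < m)%N.
Proof. by rewrite inE. Qed.

(** Replaces the ranks used by [alpha] with counts of smaller elements. The enumeration is
    increasing because it filters the increasing list of all ordinals. *)
Lemma card_before_enum_val A (j : 'I_#|A|) : #|before A (enum_val j)| = j.
Proof.
have mono (k l : 'I_#|A|) : (enum_val k < enum_val l)%N = (k < l)%N.
  have s_e : sorted ltn (map val (enum A)).
    rewrite sorted_map /enum_mem; apply: (sorted_filter (leT := relpre val ltn)).
      by move=> ? ? ?; apply: ltn_trans.
    by rewrite -enumT -sorted_map val_enum_ord iota_ltn_sorted.
  have nthE (k' : 'I_#|A|) : val (enum_val k') = nth 0%N (map val (enum A)) k'.
    by rewrite (nth_map (enum_val k')) -?cardE // -enum_val_nth.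
  rewrite !nthE -[LHS]/(ltn _ _).
  have H (k' l' : 'I_#|A|) : (k' < l')%N ->
      (nth 0%N (map val (enum A)) k' < nth 0%N (map val (enum A)) l')%N.
    move=> kl; apply: (sorted_ltn_nth ltn_trans 0%N s_e) => //;
    by rewrite inE size_map -cardE.
  case: (ltngtP k l) => [kl|lk|E]; first by rewrite /= H.
    by apply/negbTE; rewrite /= -leqNgt ltnW // H.
  by rewrite E /= ltnn.
have -> : before A (enum_val j) = [set enum_val k | k : 'I_#|A| & (k < j)%N].
  apply/setP => x; rewrite inE; apply/andP/imsetP => [[xA xj]|[k]].
    exists (enum_rank_in xA x); last by rewrite enum_rankK_in.
    by rewrite inE -mono enum_rankK_in.
  by rewrite inE => kj ->; rewrite enum_valP mono.
rewrite card_imset; last exact: enum_val_inj.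
have jA : (j <= #|A|)%N by apply: ltnW.
rewrite -sum1_card (eq_bigl (fun k : 'I_#|A| => (k < j)%N)) => [|k]; last by rewrite inE.
by rewrite (big_ord_narrow (F := fun _ => 1%N) jA) sum1_card card_ord.
Qed.

Variable K : nat.

Definition top A : {set 'I_N} := [set i in A | (#|before A i| < K)%N].

Lemma sum_top (f : 'I_N -> rat) A :
  \sum_(j < minn K #|A|) f (alpha (widen_ord (geq_minr K #|A|) j)) = \sum_(i in top A) f i.
Proof.
rewrite (eq_bigl (fun i => (i \in A) && (#|before A i| < K)%N)); last first.
  by move=> i; rewrite inE.
rewrite [RHS]big_enum_val_cond /=.
rewrite (eq_bigl (fun j : 'I_#|A| => (j < minn K #|A|)%N)); last first.
  by move=> j; rewrite card_before_enum_val leq_min ltn_ord andbT.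
by rewrite (big_ord_narrow (geq_minr K #|A|)).
Qed.

(** A point of a downward closed [X] has only other points of [X] before it, hence fewer than [K]; a
    point of [A] outside [X] has all of [X] before it. The last hypothesis covers sets [A] with
    fewer than [K] points. *)
Lemma top_downset A X : X \subset A ->
  (forall x j, x \in X -> j \in A -> (j < x)%N -> j \in X) ->
  (#|X| <= K)%N -> (#|X| < K -> X = A)%N -> top A = X.
Proof.
move=> XA Xdown XK XE; apply/setP => i; rewrite inE.
case: (boolP (i \in X)) => iX.
  rewrite (subsetP XA) //=; apply: leq_trans XK; rewrite proper_card //.
  apply/properP; split; last by exists i; rewrite // inE ltnn andbF.
  by apply/subsetP => j; rewrite inE => /andP[jA ji]; apply: Xdown ji.
apply/negbTE/negP => /andP[iA]; rewrite ltnNge => /negP[].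
case: ltnP XE => [_ /(_ isT) E|KX _]; first by rewrite E iA in iX.
apply: leq_trans KX _; apply/subset_leq_card/subsetP => j jX.
rewrite inE (subsetP XA) //= ltnNge leq_eqVlt; apply/negP => /orP[/eqP/val_inj E|ij].
  by rewrite E jX in iX.
by rewrite (Xdown _ _ jX iA ij) in iX.
Qed.

Lemma top_small A : (#|A| <= K)%N -> top A = A.
Proof. by move=> AK; apply: top_downset. Qed.

Lemma top_rank A m : m \in A -> #|before A m|.+1 = K -> top A = m |: before A m.
Proof.
move=> mA rm; have mb : m \notin before A m by rewrite inE ltnn andbF.
apply: top_downset; rewrite ?cardsU1 ?mb ?add1n ?rm ?ltnn //.
  by apply/subsetP => x; rewrite !inE => /orP[/eqP->//|/andP[]].
move=> x j; rewrite !inE => /orP[/eqP->|/andP[_ xm]] -> jx; apply/orP; right => //=.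
exact: ltn_trans jx xm.
Qed.

Lemma top_setU1_gt A m i : m \in A -> i \notin A -> #|before A m|.+1 = K -> (m < i)%N ->
  top (i |: A) = top A.
Proof.
move=> mA iA rm mi.
have Eb : before (i |: A) m = before A m.
  by apply/setP => x; rewrite !inE; case: eqP => // ->; rewrite (ltnNge i) (ltnW mi) /= andbF.
by rewrite (top_rank mA rm) -Eb; apply: top_rank; rewrite ?Eb // !inE mA orbT.
Qed.

Lemma top_setU1_lt A m i : m \in A -> i \notin A -> #|before A m|.+1 = K -> (i < m)%N ->
  top (i |: A) = i |: before A m.
Proof.
move=> mA iA rm im; have ib : i \notin before A m by rewrite inE (negbTE iA).
apply: top_downset; rewrite ?cardsU1 ?ib ?add1n ?rm ?ltnn //.
  by apply/subsetP => x; rewrite !inE => /orP[->//|/andP[->]]; rewrite orbT.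
move=> x j; rewrite !inE => xm /orP[->//|->] jx; apply/orP; right => /=.
by case/orP: xm => [/eqP xi|/andP[_ xm]]; [rewrite -xi in im|]; apply: ltn_trans jx _.
Qed.

(** A set with at least [K] points has exactly one K-th point. This allows a sum over such
    coalitions to be split according to that point. *)
Lemma sum_rank_eq (R : nmodType) A (x : R) : (0 < K)%N ->
  \sum_(m in A | #|before A m|.+1 == K) x = if (K <= #|A|)%N then x else 0.
Proof.
move=> K0; case: leqP => [KA|AK].
  have K1A : (K.-1 < #|A|)%N by rewrite prednK.
  rewrite (big_pred1 (enum_val (Ordinal K1A))) // => m /=.
  apply/andP/eqP => [[mA /eqP rm]|->]; last first.
    by rewrite card_before_enum_val /= prednK // enum_valP.
  have /eqP := card_before_enum_val (enum_rank_in mA m).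
  rewrite enum_rankK_in // => /eqP E; rewrite -[LHS](enum_rankK_in mA mA).
  by congr enum_val; apply: val_inj; rewrite /= -E -rm.
rewrite big_pred0 // => m; apply/negP => /andP[mA /eqP rm].
have : (#|m |: before A m| <= #|A|)%N.
  by apply/subset_leq_card/subsetP => j; rewrite !inE => /orP[/eqP->//|/andP[]].
by rewrite cardsU1 inE ltnn andbF /= add1n rm leqNgt AK.
Qed.

End Ranks.

Section ClassGame.
Variables (N C K : nat) (y : 'I_N -> 'I_C) (yval c : 'I_C) (w : 'I_N -> rat).
Variables (W1 : nat) (r : 'I_N -> nat).
Hypotheses (c_yval : c != yval) (K0 : (0 < K)%N) (W10 : (0 < W1)%N).
Hypotheses (rW1 : forall i, (r i <= W1)%N) (wr : forall i, w i = (r i)%:R / W1%:R).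

(* [W1 * (1 + the signed vote of the point)], which avoids negative table indices. *)
Definition shifted_vote (i : 'I_N) : nat :=
  if y i == yval then (W1 + r i)%N else (W1 - r i)%N.

(** The test that the signed votes have a nonnegative sum: each summand carries the offset [W1],
    which moves zero to [#|A| * W1]. Ties win, as in [class_utility]. *)
Definition wins (A : {set 'I_N}) : bool :=
  (#|A| * W1 <= \sum_(i in A) shifted_vote i)%N.

Lemma wins_setU1 i (A : {set 'I_N}) : i \notin A ->
  wins (i |: A) = (#|A|.+1 * W1 <= \sum_(j in A) shifted_vote j + shifted_vote i)%N.
Proof. by move=> iA; rewrite /wins cardsU1 iA big_setU1 //= add1n [X in (_ <= X)%N]addnC. Qed.

Definition relevant : {set 'I_N} := [set i | (y i == yval) || (y i == c)].

Lemma restrict_classE S : restrict_class y yval c S = S :&: relevant.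
Proof. by apply/setP => i; rewrite !inE. Qed.

Lemma winsE (A : {set 'I_N}) : A \subset relevant ->
  (\sum_(i in A) w i * (y i == c)%:R <= \sum_(i in A) w i * (y i == yval)%:R) = wins A.
Proof.
move=> AD; rewrite -subr_ge0 -sumrB /wins -(ler_nat rat) natrM natr_sum.
have W1r : 0 < W1%:R :> rat by rewrite ltr0n.
rewrite -[RHS]subr_ge0 -[LHS](pmulr_rge0 _ W1r); congr (_ <= _).
rewrite mulr_sumr mulr_natl -sumr_const.
rewrite -sumrB; apply: eq_bigr => i iA; rewrite /shifted_vote wr.
have := subsetP AD i iA; rewrite inE.
have W1n : W1%:R != 0 :> rat by rewrite lt0r_neq0.
case: eqP => [-> _|_ /= ->]; first by rewrite eq_sym (negbTE c_yval) natrD mulr1 mulr0; field.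
by rewrite natrB // mulr1 mulr0; field.
Qed.

Lemma class_utilityE S :
  class_utility K y yval w c S = (wins (top K (S :&: relevant)))%:R.
Proof.
rewrite /class_utility restrict_classE /vote.
rewrite (sum_top _ (fun i => w i * (y i == yval)%:R)) (sum_top _ (fun i => w i * (y i == c)%:R)).
rewrite winsE //; apply/subsetP => i; rewrite inE => /andP[+ _].
by rewrite inE => /andP[].
Qed.

Lemma shapley_irrelevant i : i \notin relevant -> shapley (class_utility K y yval w c) i = 0.
Proof.
move=> iD; rewrite shapleyE big1 // => S iS; rewrite !class_utilityE.
rewrite (_ : (i |: S) :&: relevant = S :&: relevant) ?subrr ?mulr0 //.
by apply/setP => j; rewrite !in_setI in_setU1; case: eqP => // ->; rewrite (negbTE iD) !andbF.
Qed.

(** In the first sum, [m] is the K-th relevant point of the coalition and [A] the set of those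
    before it exactly when the trace on [m |: (before relevant m :\ i)] is [m |: A]. This set has
    [#|before relevant m|] elements, and the trace has [K], whence the weight. In the second sum the
    trace is taken on [relevant :\ i]. *)
Lemma shapley_relevant i : i \in relevant ->
  shapley (class_utility K y yval w c) i =
  \sum_(m in relevant | (i < m)%N) pweight #|before relevant m|.+1 K *
    (\sum_(A : {set 'I_N} | (A \subset before relevant m :\ i) && (#|A| == K.-1))
      ((wins (i |: A))%:R - (wins (m |: A))%:R)) +
  \sum_(A : {set 'I_N} | (A \subset relevant :\ i) && (#|A| < K)%N)
    pweight #|relevant| #|A| * ((wins (i |: A))%:R - (wins A)%:R).
Proof.
move=> iD; rewrite shapleyE.
pose F (S : {set 'I_N}) : rat :=
  pweight N #|S| * ((wins (top K (i |: (S :&: relevant))))%:R - (wins (top K (S :&: relevant)))%:R).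
have iI (S : {set 'I_N}) : i \notin S -> i \notin S :&: relevant.
  by move=> iS; rewrite inE (negbTE iS).
have split1 (S : {set 'I_N}) : i \notin S -> pweight N #|S| *
    (class_utility K y yval w c (i |: S) - class_utility K y yval w c S) = F S.
  move=> iS; rewrite !class_utilityE /F; congr (_ * ((wins (top K _))%:R - _)).
  by rewrite setIUl (setIidPl _) // sub1set.
have bE (S : {set 'I_N}) m : i \notin S ->
    before (S :&: relevant) m = S :&: (before relevant m :\ i).
  move=> iS; apply/setP => x; rewrite !(in_setI, in_setD1, inE) -!andbA.
  by case: (eqVneq x i) => [->|_]; rewrite ?(negbTE iS).
have rE (S : {set 'I_N}) : i \notin S -> S :&: relevant = S :&: (relevant :\ i).
  move=> iS; apply/setP => x; rewrite !(in_setI, in_setD1).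
  by case: (eqVneq x i) => [->|_]; rewrite ?(negbTE iS).
rewrite (eq_bigr F) // (bigID (fun S : {set 'I_N} => #|S :&: relevant| < K)%N) /= addrC.
congr (_ + _).
  rewrite big_mkcondr /=.
  (* Each coalition with at least [K] relevant points is assigned to its K-th one. *)
  rewrite (eq_bigr (fun S : {set 'I_N} =>
     \sum_(m in relevant) if (m \in S) && (#|before (S :&: relevant) m|.+1 == K) then F S else 0));
    last first.
    move=> S iS; rewrite -leqNgt -sum_rank_eq // -big_mkcondr.
    by apply: eq_bigl => m; rewrite inE; case: (m \in S); rewrite ?andbF ?andbT.
  rewrite exchange_big /= [RHS]big_mkcondr; apply: eq_bigr => m mD.
  rewrite -big_mkcondr /=; case: ifPn => im; last first.
    (* If [i] comes after the K-th point, adding it does not change the [K] points that vote. *)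
    rewrite big1 // => S /and3P[iS mS /eqP rm].
    have mSD : m \in S :&: relevant by rewrite inE mS.
    rewrite /F (top_setU1_gt mSD) ?subrr ?mulr0 ?iI //.
    rewrite ltn_neqAle leqNgt im andbT; apply: contraNneq iS => /val_inj <- //.
  rewrite (partition_big (fun S : {set 'I_N} => S :&: (before relevant m :\ i))
     (fun A : {set 'I_N} => (A \subset before relevant m :\ i) && (#|A| == K.-1))) /=.
    rewrite mulr_sumr; apply: eq_bigr => A /andP[AB /eqP cA].
    set B := before relevant m :\ i.
    have mA : m \notin A by apply/negP => /(subsetP AB); rewrite !inE ltnn !andbF.
    have iA : i \notin A by apply/negP => /(subsetP AB); rewrite !inE eqxx.
    have mB : m \notin B by rewrite !inE ltnn !andbF.
    have im' : i != m by apply: contraTneq im => ->; rewrite ltnn.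
    (* [B] lacks [i], which lies before [m], and [m] makes up for it. *)
    have cB : #|m |: B| = #|before relevant m|.
      by rewrite cardsU1 mB (cardsD1 i (before _ m)) inE iD im.
    have := @sum_pweight_trace _ i (m |: B) (m |: A).
    rewrite cB card_ord [in X in pweight _ X]cardsU1 mA cA add1n prednK //.
    rewrite setUS // !inE eqxx (negbTE im') /= => /(_ isT isT) <-.
    rewrite mulr_suml; apply: eq_big => S.
      case: (boolP (i \in S)) => //= iS; rewrite bE //.
      apply/idP/eqP => [/andP[/andP[mS _] /eqP <-]|E].
        by apply/setP => x; rewrite !(in_setI, in_setU1); case: eqP => // ->; rewrite mS.
      have mS : m \in S by have := setU11 m A; rewrite -E inE => /andP[].
      have EA : S :&: B = A.
        apply/setP => x; have /setP/(_ x) := E; rewrite !in_setI !in_setU1.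
        by case: (eqVneq x m) => // ->; rewrite (negbTE mA) (negbTE mB) andbF.
      by rewrite mS EA cA prednK // !eqxx.
    move=> /andP[/and3P[iS mS /eqP rm] /eqP EA].
    have mSD : m \in S :&: relevant by rewrite inE mS.
    rewrite /F (top_setU1_lt mSD) ?iI // (top_rank mSD) //.
    by rewrite bE // EA.
  by move=> S /and3P[iS mS /eqP rm]; rewrite subsetIr -bE //= -rm.
rewrite (partition_big (fun S : {set 'I_N} => S :&: (relevant :\ i))
     (fun A : {set 'I_N} => (A \subset relevant :\ i) && (#|A| < K)%N)) /=.
  apply: eq_bigr => A /andP[AB cA].
  have iB : i \notin relevant :\ i by rewrite !inE eqxx.
  have := sum_pweight_trace iB AB.
  have -> : #|relevant :\ i|.+1 = #|relevant| by rewrite (cardsD1 i relevant) iD.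
  rewrite card_ord => <-; rewrite mulr_suml; apply: eq_big => S.
    case: (boolP (i \in S)) => //= iS; rewrite rE //.
    by apply/andP/eqP => [[_ /eqP]//|->].
  move=> /andP[/andP[iS sS] /eqP EA]; rewrite /F !top_small ?cardsU1 ?iI //.
    by rewrite rE // EA.
  exact: ltnW.
by move=> S /andP[iS cS]; rewrite subsetIr -rE.
Qed.

End ClassGame.

(** * Counting coalitions by a knapsack recursion *)

(** The coefficient of X^u in the product of the 1 + X^G for G in [l]. The guard [G <= u] keeps the
    truncated subtraction from contributing spurious terms. *)
Fixpoint subset_sums (l : seq nat) (u : nat) : nat :=
  if l is G :: l' then
    (subset_sums l' u + (if G <= u then subset_sums l' (u - G) else 0))%N
  else (u == 0)%N.

Lemma subset_sumsE (T : finType) (G : T -> nat) (s : seq T) u : uniq s ->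
  subset_sums [seq G j | j <- s] u =
  (\sum_(A : {set T} | A \subset [set x in s]) (\sum_(j in A) G j == u))%N.
Proof.
elim: s u => [|x s IH] u /=.
  rewrite (_ : [set x in [::]] = set0); last by apply/setP => z; rewrite !inE.
  by rewrite (big_pred1 set0) ?big_set0 1?eq_sym // => A; rewrite subset0.
move=> /andP[xs us]; rewrite !IH //.
have -> : [set z in x :: s] = x |: [set z in s] by apply/setP => z; rewrite !inE.
have xs' : x \notin [set z in s] by rewrite inE.
rewrite big_subsets_setU1 //=.
rewrite [X in (_ + X)%N = _](_ : _ = \sum_(A : {set T} | A \subset [set z in s])
  ((G x <= u) && (\sum_(j in A) G j == u - G x)))%N; last first.
  by case: leqP => Gu //; rewrite big1.
congr addn; apply: eq_bigr => A AB; congr nat_of_bool.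
rewrite big_setU1 /=; last by apply: contra xs' => /(subsetP AB).
by case: leqP => Gu /=; lia.
Qed.

(* Adding a large constant [Wd] to every item makes the sum of a set encode its size. *)
Lemma sum_subsets_layer (T : finType) (g : T -> nat) (s : seq T) (M K l Wd : nat)
    (h : nat -> rat) :
  uniq s -> (forall j, g j <= M)%N -> (l < K)%N -> (K * M < Wd)%N ->
  \sum_(A : {set T} | (A \subset [set x in s]) && (#|A| == l)) h (\sum_(j in A) g j)%N =
  \sum_(a < Wd) (subset_sums [seq (Wd + g j)%N | j <- s] (l * Wd + a))%:R * h a.
Proof.
move=> us gM lK KM.
under [RHS]eq_bigr => a _ do
  rewrite (subset_sumsE (fun j => (Wd + g j)%N)) // natr_sum mulr_suml.
rewrite exchange_big /= big_mkcondr /=; apply: eq_bigr => A _.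
have -> : (\sum_(j in A) (Wd + g j) = #|A| * Wd + \sum_(j in A) g j)%N.
  by rewrite big_split /= sum_nat_const.
have gA : (\sum_(j in A) g j <= #|A| * M)%N by rewrite -sum_nat_const leq_sum.
case: eqP => [E|NE].
  have ltW : (\sum_(j in A) g j < Wd)%N.
    by apply: leq_ltn_trans gA _; apply: leq_ltn_trans KM; rewrite leq_mul2r E ltnW ?orbT.
  rewrite (bigD1 (Ordinal ltW)) //= E eqxx mul1r [X in _ + X]big1 ?addr0 // => a na.
  rewrite eqn_add2l; case: eqP => [Ea|_]; rewrite ?mul0r //.
  by case/eqP: na; apply: val_inj.
rewrite big1 // => a _; case: eqP => [Ea|]; rewrite ?mul0r //.
(* A set of another size cannot hit layer [l]. With fewer elements, its votes sum to less than the
   missing [Wd]; with more, the sizes alone exceed [l * Wd + a], as [a < Wd]. *)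
case: a Ea => a /= aW; case: (ltngtP #|A| l) => // [Al|lA].
  have : (#|A| * M <= K * M)%N by rewrite leq_mul2r (ltnW (ltn_trans Al lK)) orbT.
  have : (#|A|.+1 * Wd <= l * Wd)%N by rewrite leq_mul2r Al orbT.
  rewrite mulSn; lia.
have : (l.+1 * Wd <= #|A| * Wd)%N by rewrite leq_mul2r lA orbT.
rewrite mulSn; lia.
Qed.

Section ClassKnapsack.
Variables (N C K : nat) (y : 'I_N -> 'I_C) (yval c : 'I_C) (w : 'I_N -> rat).
Variables (W1 Wd : nat) (r : 'I_N -> nat).
Hypotheses (c_yval : c != yval) (K0 : (0 < K)%N) (W10 : (0 < W1)%N).
Hypotheses (rW1 : forall i, (r i <= W1)%N) (wr : forall i, w i = (r i)%:R / W1%:R).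
Hypothesis KWd : (K * (2 * W1) < Wd)%N.

Let D := relevant y yval c.
Let g := shifted_vote y yval W1 r.
Variable x0 : 'I_N.
Let e (j : nat) : 'I_N := nth x0 (enum D) j.

(** Reversed, so that passing from [m] to [m.+1] puts the new item at the head, where [subset_sums]
    has its recursion step. *)
Definition others (gs : nat -> nat) (i m : nat) : seq nat :=
  [seq (Wd + gs j)%N | j <- rev (iota 0 m) & j != i].

(** The formula of [shapley_relevant] with points replaced by their positions among the relevant
    ones. Here [a] is the sum of the shifted votes of the coalition, and the factor of [W1] in each
    test is the number of points that vote. *)
Definition class_value (gs : nat -> nat) (n i : nat) : rat :=
  \sum_(0 <= m < n | (i < m)%N) \sum_(0 <= a < Wd)
     pweight m.+1 K * (subset_sums (others gs i m) (K.-1 * Wd + a))%:R *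
     ((K * W1 <= a + gs i)%:R - (K * W1 <= a + gs m)%:R) +
  \sum_(0 <= l < K) \sum_(0 <= a < Wd)
     pweight n l * (subset_sums (others gs i n) (l * Wd + a))%:R *
     ((l.+1 * W1 <= a + gs i)%:R - (l * W1 <= a)%:R).

Lemma shapley_class_value i : (i < #|D|)%N ->
  shapley (class_utility K y yval w c) (e i) = class_value (fun j => g (e j)) #|D| i.
Proof.
move=> iD.
have sz : size (enum D) = #|D| by rewrite -cardE.
have eP j : (j < #|D|)%N -> e j \in D by move=> jD; rewrite -mem_enum mem_nth ?sz.
have e_inj j k : (j < #|D|)%N -> (k < #|D|)%N -> (e j == e k) = (j == k).
  by move=> jD kD; rewrite nth_uniq ?sz ?enum_uniq.
have eV (j : 'I_#|D|) : e j = enum_val j by rewrite /e (enum_val_nth x0).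
have before_lt j m : (j < #|D|)%N -> (m < #|D|)%N -> (e j < e m)%N = (j < m)%N.
  move=> jD mD; have H k l : (k < #|D|)%N -> (l < #|D|)%N -> (k <= l)%N -> (e k <= e l)%N.
    move=> kD lD kl; rewrite leqNgt; apply/negP => lek.
    have := card_before_enum_val (Ordinal kD); have := card_before_enum_val (Ordinal lD).
    rewrite -!eV /= => E1 E2; move: kl; rewrite -E1 -E2 leqNgt => /negP[].
    rewrite proper_card //; apply/properP; split.
      by apply/subsetP => z; rewrite !in_before => /andP[-> zl]; rewrite (ltn_trans zl).
    by exists (e l); rewrite !in_before ?ltnn ?andbF ?eP.
  apply/idP/idP => [|jm]; first by rewrite !ltnNge; apply: contra; apply: H.
  by rewrite ltn_neqAle H ?(ltnW jm) // andbT -[_ == _]/(e j == e m) e_inj // neq_ltn jm.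
(* The case [m = #|D|], where no point [e m] exists, gives all of [D]; the sum over small coalitions
   uses it. *)
have beforeE m : (m <= #|D|)%N -> [set z in [seq e j | j <- rev (iota 0 m) & j != i]] =
    (if (m < #|D|)%N then before D (e m) else D) :\ e i.
  move=> mD; apply/setP => z; rewrite inE; apply/mapP/idP.
    move=> [j]; rewrite mem_filter mem_rev mem_iota add0n /= => /andP[ji jm] ->.
    have jD : (j < #|D|)%N by apply: leq_trans jm mD.
    by rewrite in_setD1 e_inj // ji; case: ifP => mD' /=; rewrite ?in_before ?eP ?before_lt.
  rewrite in_setD1 => /andP[zi zD].
  have zD' : z \in D by move: zD; case: ifP => // _; rewrite in_before => /andP[].
  have zE : z = e (index z (enum D)) by rewrite /e nth_index // mem_enum.
  have iz : (index z (enum D) < #|D|)%N by rewrite -sz index_mem mem_enum.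
  exists (index z (enum D)) => //; rewrite mem_filter mem_rev mem_iota add0n /=.
  rewrite -(e_inj _ _ iz iD) -zE zi /=.
  case: ltnP zD => [mD' zb|Dm _]; last exact: leq_trans iz _.
  by move: zb; rewrite in_before zD' [in X in X -> _]zE before_lt.
have us m : (m <= #|D|)%N -> uniq [seq e j | j <- rev (iota 0 m) & j != i].
  move=> mD; rewrite map_inj_in_uniq ?filter_uniq ?rev_uniq ?iota_uniq //.
  move=> j k; rewrite !mem_filter !mem_rev !mem_iota !add0n /= => /andP[_ jm] /andP[_ km].
  by move/eqP; rewrite e_inj ?(leq_trans jm mD) ?(leq_trans km mD) // => /eqP.
have gW z : (g z <= 2 * W1)%N.
  by rewrite /g /shifted_vote; have := rW1 z; case: ifP; lia.
rewrite (shapley_relevant (W1 := W1) (r := r)) ?eP // -/D /class_value; congr (_ + _).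
  rewrite -big_enum_cond /= (big_nth x0) sz [LHS]big_nat_cond [RHS]big_nat_cond.
  apply: eq_big => [m|m /andP[/andP[_ mD] im]].
    by case: (ltnP m #|D|) => mD //=; rewrite before_lt.
  have := card_before_enum_val (Ordinal mD); rewrite -eV /= -/(e m) => ->.
  have := beforeE m (ltnW mD); rewrite mD => <-.
  under [RHS]eq_bigr => a _ do rewrite -mulrA.
  rewrite -mulr_sumr big_mkord /others; congr (_ * _).
  have -> : [seq (Wd + g (e j))%N | j <- rev (iota 0 m) & j != i] =
      [seq (Wd + g z)%N | z <- [seq e j | j <- rev (iota 0 m) & j != i]] by rewrite -map_comp.
  rewrite -(sum_subsets_layer (K := K) (M := (2 * W1)%N)
    (fun a => (K * W1 <= a + g (e i))%:R - (K * W1 <= a + g (e m))%:R)) ?prednK ?us ?(ltnW mD) //.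
  apply: eq_bigr => A /andP[]; rewrite beforeE ?(ltnW mD) // mD => AB /eqP cA.
  have iA : e i \notin A by apply/negP => /(subsetP AB); rewrite in_setD1 eqxx.
  have mA : e m \notin A by apply/negP => /(subsetP AB); rewrite in_setD1 in_before ltnn !andbF.
  by rewrite !wins_setU1 // cA prednK.
rewrite big_mkcondr /=.
(* The small coalitions are sorted by size, each size being one layer of the table. *)
rewrite (eq_bigr (fun A : {set 'I_N} => \sum_(l < K) if #|A| == l then
    pweight #|D| #|A| * ((wins y yval W1 r (e i |: A))%:R - (wins y yval W1 r A)%:R) else 0)).
  rewrite exchange_big /= big_mkord; apply: eq_bigr => l _.
  under [RHS]eq_bigr => a _ do rewrite -mulrA.
  rewrite -mulr_sumr big_mkord /others -big_mkcondr /=.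
  have -> : [seq (Wd + g (e j))%N | j <- rev (iota 0 #|D|) & j != i] =
      [seq (Wd + g z)%N | z <- [seq e j | j <- rev (iota 0 #|D|) & j != i]] by rewrite -map_comp.
  rewrite -(sum_subsets_layer (K := K) (M := (2 * W1)%N)
    (fun a => (l.+1 * W1 <= a + g (e i))%:R - (l * W1 <= a)%:R)) ?us //.
  have := beforeE #|D| (leqnn _); rewrite ltnn => ->.
  rewrite mulr_sumr; apply: eq_bigr => A /andP[AB /eqP cA].
  have iA : e i \notin A by apply/negP => /(subsetP AB); rewrite in_setD1 eqxx.
  by rewrite wins_setU1 // cA /wins cA.
move=> A _; case: ltnP => AK.
  rewrite (bigD1 (Ordinal AK)) //= eqxx big1 ?addr0 // => l /eqP nl.
  by case: eqP => // E; case: nl; apply: val_inj.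
by rewrite big1 // => -[l lK] _; case: eqP => //= E; lia.
Qed.

End ClassKnapsack.

(** * The program *)

Definition getN := NGet 0 (NConst 0).
Definition getC := NGet 0 (NConst 1).
Definition getK := NGet 0 (NConst 2).
Definition getb := NGet 0 (NConst 3).
Definition getyval := NGet 0 (NConst 4).

Notation aLabel := 1%N (only parsing).
Notation aVote := 2%N (only parsing).
Notation aHead := 3%N (only parsing).
Notation aNext := 4%N (only parsing).
Notation aPoint := 5%N (only parsing).
Notation vW1 := 6%N (only parsing).
Notation vWd := 7%N (only parsing).
Notation vL := 8%N (only parsing).
Notation vKW1 := 9%N (only parsing).
Notation vc := 10%N (only parsing).
Notation vn := 11%N (only parsing).
Notation vi := 12%N (only parsing).
Notation vm := 13%N (only parsing).
Notation vu := 14%N (only parsing).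
Notation vk := 15%N (only parsing).
Notation vla := 16%N (only parsing).
Notation vlb := 17%N (only parsing).
Notation vbase := 18%N (only parsing).
Notation vlW1 := 19%N (only parsing).
Notation vG := 20%N (only parsing).
Notation vW := 21%N (only parsing).
Notation vr := 22%N (only parsing).
Notation qWeight := 0%N (only parsing).
Notation qOut := 1%N (only parsing).
Notation qTable := 2%N (only parsing).
Notation qAcc := 3%N (only parsing).
Notation qP := 4%N (only parsing).

Definition oneN := NConst 1.
Definition setn x e := NSet x (NConst 0) e.
Definition setq x e := QSet x (NConst 0) e.
Definition Vq x := QGet x (NConst 0).
Definition vote_of v := NGet aVote (NGet aPoint (V v)).

(* The table is updated from the top down, so that each item is used at most once. *)
Definition insert_cmd :=
  let addr := NSub (NSub (V vL) oneN) (V vu) in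
  Seq (setn vG (NAdd (V vWd) (vote_of vm)))
    (For vu (NSub (V vL) (V vG))
       (QSet qTable addr (QAdd (QGet qTable addr) (QGet qTable (NSub addr (V vG)))))).

Definition acc_if (op : qexp -> qexp -> qexp) e addr :=
  If e (setq qAcc (op (Vq qAcc) (QMul (Vq qP) (QGet qTable addr)))) Skip.

(** [qP] reaches [pweight m.+1 K] through the successive ratios of [pweightS], and [L - Wd] is the
    first address of layer [K.-1]. The [K] rounds for the weight and the [Wd] rounds for the sum
    stay within the [L] rounds allowed for an insertion. *)
Definition swing_cmd :=
  let addr := NAdd (NSub (V vL) (V vWd)) (V vu) in
  Seq (setq qP (QDiv (QConst 1) (QNat (NAdd (V vm) oneN))))
  (Seq (For vk getK
          (setq qP (QMul (Vq qP) (QDiv (QNat (NAdd (V vk) oneN)) (QNat (NSub (V vm) (V vk)))))))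
  (For vu (V vWd)
     (Seq (acc_if QAdd (BNLe (V vKW1) (NAdd (V vu) (vote_of vi))) addr)
          (acc_if QSub (BNLe (V vKW1) (NAdd (V vu) (vote_of vm))) addr)))).

(** [vbase] and [vlW1] follow [k * Wd] and [k * W1] by addition, as naturals have no product. The
    weight is carried from layer to layer; a divisor that reaches 0 gives the value 0, in agreement
    with [pweightS]. *)
Definition small_cmd :=
  let addr := NAdd (V vbase) (V vu) in
  Seq (setq qP (QDiv (QConst 1) (QNat (V vn))))
  (Seq (setn vbase (NConst 0))
  (Seq (setn vlW1 (NConst 0))
  (For vk getK
    (Seq (For vu (V vWd)
           (Seq (acc_if QAdd (BNLe (NAdd (V vlW1) (V vW1)) (NAdd (V vu) (vote_of vi))) addr)
                (acc_if QSub (BNLe (V vlW1) (V vu)) addr)))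
    (Seq (setq qP (QMul (Vq qP) (QDiv (QNat (NAdd (V vk) oneN))
                                      (QNat (NSub (NSub (V vn) oneN) (V vk))))))
    (Seq (setn vbase (NAdd (V vbase) (V vWd)))
         (setn vlW1 (NAdd (V vlW1) (V vW1))))))))).

(** The table is read for [m] before [m] enters it, when it counts the coalitions among the earlier
    points; [i] is never inserted. *)
Definition step_cmd :=
  Seq (If (BNLe (NAdd (V vi) oneN) (V vm)) swing_cmd Skip)
      (If (BAnd (BNLe (V vi) (V vm)) (BNLe (V vm) (V vi))) Skip insert_cmd).

(** Cell 0 of the fresh table counts the empty coalition. The result is added to the output cell
    rather than stored in it, because a point with label [yval] is relevant for every class. *)
Definition point_cmd :=
  Seq (For vu (V vL) (QSet qTable (V vu) (QConst 0)))
  (Seq (QSet qTable (NConst 0) (QConst 1))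
  (Seq (setq qAcc (QConst 0))
  (Seq (For vm (V vn) step_cmd)
  (Seq small_cmd
    (let out := NGet aPoint (V vi) in
     QSet qOut out (QAdd (QGet qOut out)
       (QDiv (Vq qAcc) (QSub (QNat getC) (QConst 1))))))))).

(** * Correctness and cost of the computation for one class and one point *)

Record ctx (K W1 Wd n : nat) (gs : nat -> nat) (s : state) : Prop := Ctx {
  ctxK : nat_mem s 0 2 = K;
  ctxW1 : nat_mem s vW1 0 = W1;
  ctxWd : nat_mem s vWd 0 = Wd;
  ctxL : nat_mem s vL 0 = (K * Wd)%N;
  ctxKW1 : nat_mem s vKW1 0 = (K * W1)%N;
  ctxn : nat_mem s vn 0 = n;
  ctxg : forall j, (j < n)%N -> nat_mem s aVote (nat_mem s aPoint j) = gs j }.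

Lemma ctx_agree K W1 Wd n gs ns qs s s' : agree ns qs s s' ->
  all (fun a => a \notin ns) [:: 0; aVote; aPoint; vW1; vWd; vL; vKW1; vn]%N ->
  ctx K W1 Wd n gs s -> ctx K W1 Wd n gs s'.
Proof.
move=> [a _] /= /and5P[h0 h1 h2 h3 /and5P[h4 h5 h6 h7 _]] [*].
by split; rewrite ?a // => j jn; rewrite !a //; auto.
Qed.

Section Correctness.
Variables (K W1 Wd n : nat) (gs : nat -> nat).
Hypotheses (K0 : (0 < K)%N) (Wd0 : (0 < Wd)%N).
Local Notation L := (K * Wd)%N.
Local Notation ctx := (ctx K W1 Wd n gs).

Definition table (l : seq nat) (s : state) : Prop :=
  forall u, (u < L)%N -> rat_mem s qTable u = (subset_sums l u)%:R.

Lemma wp_insert s m l : ctx s -> nat_mem s vm 0 = m -> (m < n)%N -> table l s ->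
  wp insert_cmd s L.+1 (table ((Wd + gs m)%N :: l)).
Proof.
move=> cs ms mn tl; apply: wp_seq => //; apply: wp_nset => //=.
rewrite (ctxWd cs) ms (ctxg cs) //; set G := (Wd + gs m)%N; set s0 := nset _ _ _ _.
have cs0 : ctx s0 by apply: ctx_agree cs; first exact: (@agree_nset [:: vG] [::]).
apply: (wp_conseq (X := (L - G).+1 * 1)) => [|//|]; last 2 first.
- by rewrite muln1 ltnS leq_subr.
- by move=> s' _; exact.
(* After [k] rounds the [k] topmost cells are updated. Cell [u] reads cell [u - G], which is still
   old because [G >= Wd > 0]. *)
apply: (@wp_for _ _ _ _ _ _ (fun k s' => forall u, (u < L)%N ->
   rat_mem s' qTable u = (subset_sums (if (u < L - k)%N then l else G :: l) u)%:R)) => //.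
- move=> s' a /=; rewrite !a.1 //= /store /= (ctxL cs); done.
- by move=> u uL /=; rewrite subn0 uL; apply: tl.
- move=> k s' a kL ks I; have cs' := ctx_agree a isT cs0.
  have Gs' : nat_mem s' vG 0 = G by rewrite a.1.
  apply: wp_qset => //= u uL; rewrite (ctxL cs') ks Gs' /store /=.
  case: eqP => [E|NE].
    rewrite -E !I; try lia.
    have -> : (u < L - k)%N by lia.
    have -> : (u < L - k.+1)%N = false by lia.
    have -> : (u - G < L - k)%N by lia.
    have Gu : (G <= u)%N by lia.
    by rewrite /= Gu natrD.
  rewrite I //; congr ((subset_sums (if _ then _ else _) _)%:R); lia.
move=> s' a I u uL; rewrite I //; case: ltnP => // uG.
(* The cells below [G] are never visited: the new item does not fit into such a sum, so their counts
   stay valid. *)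
have uG' : (u < G)%N by lia.
by rewrite /= leqNgt uG' addn0.
Qed.

(** The inner loop of both sums of [class_value]. The tests are specified in every state that
    differs only in [vu] and [qAcc], so that the specification applies again after the first
    conditional has changed the accumulator (state [s1] below). *)
Lemma wp_acc_loop e1 e2 addr s (p : rat) (f : nat -> rat) (b1 b2 : nat -> bool) :
  nat_mem s vWd 0 = Wd -> rat_mem s qP 0 = p ->
  (forall s' a, agree [:: vu] [:: qAcc] s s' -> nat_mem s' vu 0 = a -> (a < Wd)%N ->
     [/\ beval s' e1 = b1 a, beval s' e2 = b2 a & rat_mem s' qTable (neval s' addr) = f a]) ->
  wp (For vu (V vWd) (Seq (acc_if QAdd e1 addr) (acc_if QSub e2 addr))) s Wd.+1
    (fun s' => rat_mem s' qAcc 0 = rat_mem s qAcc 0 +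
       \sum_(0 <= a < Wd) p * f a * ((b1 a)%:R - (b2 a)%:R)).
Proof.
move=> sWd sp H; rewrite -[Wd.+1]muln1.
have sub s' : agree [:: vu] [:: qAcc; qAcc] s s' -> agree [:: vu] [:: qAcc] s s'.
  by move=> a; apply: agree_all a _ _.
apply: (@wp_for _ _ _ _ _ _ (fun k s' => rat_mem s' qAcc 0 = rat_mem s qAcc 0 +
       \sum_(0 <= a < k) p * f a * ((b1 a)%:R - (b2 a)%:R))) => //.
- by move=> s' /= a; rewrite a.1.
- by rewrite /= big_geq // addr0.
move=> k s' /= /sub a kW ks I; have [h1 h2 h3] := H s' k a ks kW.
rewrite big_nat_recr //= addrA -I.
have ps' : rat_mem s' qP 0 = p by rewrite a.2.
pose s1 := if b1 k then qset s' qAcc 0 (rat_mem s' qAcc 0 + p * f k) else s'.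
have a1 : agree [:: vu] [:: qAcc] s s1.
  apply: agree_trans a _; rewrite /s1; case: ifP => _; first exact: agree_qset.
  exact: agree_refl.
have [|_ h2' h3'] := H s1 k a1 _ kW; first by rewrite /s1; case: ifP.
have ps1 : rat_mem s1 qP 0 = p by rewrite a1.2.
have acc1 : rat_mem s1 qAcc 0 = rat_mem s' qAcc 0 + p * f k * (b1 k)%:R.
  by rewrite /s1; case: ifP; rewrite /= /store /= ?mulr1 ?mulr0 ?addr0.
have step2 : wp (acc_if QSub e2 addr) s1 1 (fun s2 => rat_mem s2 qAcc 0 =
    rat_mem s' qAcc 0 + p * f k * ((b1 k)%:R - (b2 k)%:R)).
  rewrite /acc_if; apply: wp_if => //; rewrite h2' => hb.
    by apply: wp_qset => //=; rewrite /store /= ps1 h3' acc1 hb mulrBr mulr1 addrA.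
  by apply: wp_skip => //; rewrite acc1 (negbTE hb) subr0.
apply: wp_seq => //; rewrite {1}/acc_if; apply: wp_if => //; rewrite h1 => hb.
  by apply: wp_qset => //=; rewrite ps' h3; move: step2; rewrite /s1 hb.
by apply: wp_skip => //; move: step2; rewrite /s1 (negbTE hb).
Qed.

Lemma wp_swing s i m l : ctx s -> nat_mem s vi 0 = i -> (i < n)%N ->
  nat_mem s vm 0 = m -> (m < n)%N -> table l s ->
  wp swing_cmd s L.+1 (fun s' => rat_mem s' qAcc 0 = rat_mem s qAcc 0 +
    \sum_(0 <= a < Wd) pweight m.+1 K * (subset_sums l (K.-1 * Wd + a))%:R *
      ((K * W1 <= a + gs i)%N%:R - (K * W1 <= a + gs m)%N%:R)).
Proof.
move=> cs is_ ltin ms ltmn tl.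
apply: wp_seq => //; apply: wp_qset => //=; rewrite ms addn1 mul1r; set s0 := qset _ _ _ _.
have a0 : agree [:: vk; vu] [:: qP] s s0 by apply: agree_qset.
have KL : (K.+1 <= L.+1)%N by rewrite ltnS leq_pmulr.
have WL : (Wd.+1 <= L.+1)%N by rewrite ltnS leq_pmull.
apply: wp_seq => //; apply: (wp_conseq (X := K.+1 * 1) (Q := fun s' =>
    rat_mem s' qP 0 = pweight m.+1 K)) => [||s1 a1 P1].
- apply: (@wp_for _ _ _ _ _ _ (fun k s' => rat_mem s' qP 0 = pweight m.+1 k)) => //.
  + by move=> s' a /=; rewrite a.1 //= (ctxK cs).
  + by rewrite pweight0 /= /store.
  move=> k s' a kK ks I; apply: wp_qset => //=; rewrite /store /= I ks addn1.
  by rewrite a.1 //= ms pweightS.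
- by rewrite muln1.
have a01 : agree [:: vk; vu] [:: qP] s s1.
  by apply: agree_trans a0 _; apply: agree_all a1 _ _.
have cs1 := ctx_agree a01 isT cs.
apply: (wp_conseq (@wp_acc_loop _ _ _ _ (pweight m.+1 K)
  (fun a => (subset_sums l (K.-1 * Wd + a))%:R) (fun a => K * W1 <= a + gs i)%N
  (fun a => K * W1 <= a + gs m)%N _ _ _)) => [||||s2 a2 ->] //; last by rewrite a01.2.
  by rewrite (ctxWd cs1).
move=> s' a ag as_ aW; have cs' := ctx_agree ag isT cs1.
rewrite /= (ctxKW1 cs') as_ !(ctxg cs') ?(ctxL cs') ?(ctxWd cs');
  rewrite ?[nat_mem s' vi 0]ag.1 ?[nat_mem s' vm 0]ag.1 ?[nat_mem s1 vi 0]a01.1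
    ?[nat_mem s1 vm 0]a01.1 ?is_ ?ms //.
split=> //; rewrite ag.2 // a01.2 //.
have -> : (L - Wd = K.-1 * Wd)%N by rewrite -{1}(prednK K0) mulSn addKn.
apply: tl; rewrite -{2}(prednK K0) mulSn; lia.
Qed.

Lemma othersS i m : others Wd gs i m.+1 =
  if m == i then others Wd gs i m else (Wd + gs m)%N :: others Wd gs i m.
Proof.
by rewrite /others -addn1 iotaD rev_cat /= add0n; case: (m == i).
Qed.

Definition swing i m : rat :=
  \sum_(0 <= a < Wd) pweight m.+1 K * (subset_sums (others Wd gs i m) (K.-1 * Wd + a))%:R *
      ((K * W1 <= a + gs i)%N%:R - (K * W1 <= a + gs m)%N%:R).

Lemma wp_step s i m : ctx s -> nat_mem s vi 0 = i -> (i < n)%N ->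
  nat_mem s vm 0 = m -> (m < n)%N -> table (others Wd gs i m) s ->
  wp step_cmd s L.+1 (fun s' => table (others Wd gs i m.+1) s' /\
    rat_mem s' qAcc 0 = rat_mem s qAcc 0 + if (i < m)%N then swing i m else 0).
Proof.
move=> cs is_ ltin ms ltmn tl; apply: wp_seq => //.
apply: (wp_conseq (X := L.+1) (Q := fun s1 =>
  rat_mem s1 qAcc 0 = rat_mem s qAcc 0 + if (i < m)%N then swing i m else 0))
  => [|//|s1 a1 A1].
  apply: wp_if => //=; rewrite is_ ms addn1 => im.
    by rewrite im; apply: wp_swing.
  by apply: wp_skip => //; rewrite (negbTE im) addr0.
have cs1 := ctx_agree a1 isT cs.
have t1 : table (others Wd gs i m) s1 by move=> u uL; rewrite a1.2 // tl.
have is1 : nat_mem s1 vi 0 = i by rewrite a1.1.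
have ms1 : nat_mem s1 vm 0 = m by rewrite a1.1.
rewrite othersS; apply: wp_if => //=; rewrite is1 ms1 -eqn_leq eq_sym => im.
  by rewrite im; apply: wp_skip.
rewrite (negbTE im); apply: wp_conseq (wp_insert cs1 ms1 ltmn t1) _ _ => // s2 a2 t2.
by split=> //; rewrite a2.2.
Qed.

Lemma wp_small s i l : ctx s -> nat_mem s vi 0 = i -> (i < n)%N -> table l s ->
  wp small_cmd s (K.+1 * Wd.+1) (fun s' => rat_mem s' qAcc 0 = rat_mem s qAcc 0 +
    \sum_(0 <= k < K) \sum_(0 <= a < Wd) pweight n k * (subset_sums l (k * Wd + a))%:R *
      ((k.+1 * W1 <= a + gs i)%N%:R - (k * W1 <= a)%N%:R)).
Proof.
move=> cs is_ ltin tl.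
apply: wp_seq => //; apply: wp_qset => //=; rewrite mul1r (ctxn cs).
apply: wp_seq => //; apply: wp_nset => //=.
apply: wp_seq => //; apply: wp_nset => //=; set s0 := nset _ _ _ _.
have a0 : agree [:: vbase; vlW1; vk; vu] [:: qP; qAcc] s s0.
  by apply: agree_trans (agree_trans (agree_qset _ _ _ _ _) (agree_nset _ _ _ _ _))
    (agree_nset _ _ _ _ _).
have cs0 := ctx_agree a0 isT cs.
apply: (@wp_for _ _ _ _ _ _ (fun k s' => [/\ rat_mem s' qP 0 = pweight n k,
   nat_mem s' vbase 0 = (k * Wd)%N, nat_mem s' vlW1 0 = (k * W1)%N &
   rat_mem s' qAcc 0 = rat_mem s qAcc 0 +
    \sum_(0 <= j < k) \sum_(0 <= a < Wd) pweight n j * (subset_sums l (j * Wd + a))%:R *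
      ((j.+1 * W1 <= a + gs i)%N%:R - (j * W1 <= a)%N%:R)])) => //.
- by move=> s' a; rewrite /= a.1 // (ctxK cs0).
- by split=> //=; rewrite ?big_geq // ?addr0 /store //= pweight0.
- move=> k s1 a01 kK ks [P1 b1 w1 A1].
  have a1 : agree [:: vbase; vlW1; vk; vu] [:: qP; qAcc] s s1.
    by apply: agree_trans a0 _; apply: agree_all a01 _ _.
  have cs1 := ctx_agree a1 isT cs.
  apply: wp_seq => //.
  apply: (wp_conseq (@wp_acc_loop _ _ _ _ (pweight n k)
    (fun a => (subset_sums l (k * Wd + a))%:R) (fun a => k.+1 * W1 <= a + gs i)%N
    (fun a => k * W1 <= a)%N _ _ _)) => [||||s2 a2 A2] //.
  + by rewrite (ctxWd cs1).
  + move=> s' a ag as_ aW; have cs' := ctx_agree ag isT cs1.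
    rewrite /= as_ !(ctxg cs') ?(ctxW1 cs') ?[nat_mem s' vlW1 0]ag.1 ?[nat_mem s' vbase 0]ag.1
      ?[nat_mem s' vi 0]ag.1 ?[nat_mem s1 vi 0]a1.1 ?is_ ?w1 ?b1 //.
    split=> //; first by rewrite mulSn addnC.
    rewrite ag.2 // a1.2 //; apply: tl.
    apply: (@leq_trans (k.+1 * Wd)); first by rewrite mulSn; lia.
    by rewrite leq_mul2r kK orbT.
  have a2' : agree [:: vbase; vlW1; vk; vu] [:: qP; qAcc] s s2.
    by apply: agree_trans a1 _; apply: agree_all a2 _ _.
  have cs2 := ctx_agree a2' isT cs.
  apply: wp_seq => //; apply: wp_qset => //=.
  apply: wp_seq => //; apply: wp_nset => //=.
  apply: wp_nset => //=; rewrite /store /=; split.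
  + by rewrite a2.2 // P1 (a2.1 vk) // ks addn1 (ctxn cs2) subn1 pweightS.
  + by rewrite (a2.1 vbase) // b1 (ctxWd cs2) mulSn addnC.
  + by rewrite (a2.1 vlW1) // w1 (ctxW1 cs2) mulSn addnC.
  by rewrite big_nat_recr //= A2 A1 addrA.
by move=> s' _ [].
Qed.

Lemma wp_point s i : ctx s -> nat_mem s vi 0 = i -> (i < n)%N ->
  wp point_cmd s (n.+1 * (4 * L)) (fun s' => forall j,
    rat_mem s' qOut j = rat_mem s qOut j +
      if j == nat_mem s aPoint i
      then class_value K W1 Wd gs n i / ((nat_mem s 0 1)%:R - 1) else 0).
Proof.
move=> cs is_ ltin.
have L0 : (0 < L)%N by rewrite muln_gt0 K0.
have X0 : (0 < n.+1 * (4 * L))%N by rewrite !muln_gt0 K0.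
have XL : (4 * L <= n.+1 * (4 * L))%N by rewrite leq_pmull.
pose ag := agree [:: vm; vu; vk; vbase; vlW1; vG] [:: qP; qAcc; qTable].
have agc s' : ag s s' -> ctx s' by move=> a; apply: ctx_agree a isT cs.
apply: wp_seq => //.
apply: (wp_conseq (X := L.+1 * 1) (Q := fun s' => forall u, (u < L)%N ->
    rat_mem s' qTable u = 0)) => [||s1 a1 T1].
- apply: (@wp_for _ _ _ _ _ _ (fun k s' => forall u, (u < k)%N ->
    rat_mem s' qTable u = 0)) => //.
  + by move=> s' a; rewrite /= a.1 //= (ctxL cs).
  move=> k s' a kL ks I; apply: wp_qset => //= u uk; rewrite /store ks /=.
  by case: eqP => // uk'; apply: I; lia.
- lia.
have {a1} a1 : ag s s1 by apply: agree_all a1 _ _.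
apply: wp_seq => //; apply: wp_qset => //=.
apply: wp_seq => //; apply: wp_qset => //=; set s2 := qset _ _ _ _.
have a2 : ag s s2.
  by apply: agree_trans (agree_trans a1 (agree_qset _ _ _ _ _)) (agree_qset _ _ _ _ _).
have cs2 := agc _ a2.
have T2 : table (others Wd gs i 0) s2.
  by move=> u uL; rewrite /= /store /=; case: eqP => // _; apply: T1.
have A2 : rat_mem s2 qAcc 0 = 0 by [].
apply: wp_seq => //.
apply: (wp_conseq (X := n.+1 * L.+1) (Q := fun s' => table (others Wd gs i n) s' /\
    rat_mem s' qAcc 0 = \sum_(0 <= m < n | (i < m)%N) swing i m)) => [||s3 a3 [T3 A3]].
- apply: (@wp_for _ _ _ _ _ _ (fun k s' => table (others Wd gs i k) s' /\
    rat_mem s' qAcc 0 = \sum_(0 <= m < k | (i < m)%N) swing i m)) => //.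
  + by move=> s' a; rewrite /= a.1 // (ctxn cs2).
  + by split=> //; rewrite big_geq.
  move=> k s' a kn ks [Tk Ak].
  have a' : ag s s' by apply: agree_trans a2 _; apply: agree_all a _ _.
  have is' : nat_mem s' vi 0 = i by rewrite a'.1.
  apply: wp_conseq (wp_step (agc _ a') is' ltin ks kn Tk) _ _ => // s'' _ [Tk' Ak'].
  by split=> //; rewrite /= Ak' big_mkcond big_nat_recr //= -big_mkcond Ak.
- by rewrite leq_mul2l; lia.
have {}a3 : ag s s3 by apply: agree_trans a2 _; apply: agree_all a3 _ _.
have cs3 := agc _ a3; have is3 : nat_mem s3 vi 0 = i by rewrite a3.1.
apply: wp_seq => //; apply: wp_conseq (wp_small cs3 is3 ltin T3) _ _ => [|s4 a4 A4].
  (* This is the origin of the factor 4: [K.+1 * Wd.+1 <= 4 * (K * Wd)]. *)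
  apply: leq_trans XL; nia.
have {}a4 : ag s s4 by apply: agree_trans a3 _; apply: agree_all a4 _ _.
apply: wp_qset => //= j; rewrite /store /= (a4.1 vi) // is_ !(a4.1 aPoint) // !(a4.1 0%N) //.
rewrite !(a4.2 qOut) //; case: eqP => [->|]; last by rewrite addr0.
by rewrite A4 A3.
Qed.
End Correctness.

(** * Merging the linked lists of two labels *)

Definition take_cmd v :=
  Seq (NSet aPoint (V vn) (V v))
  (Seq (setn v (NGet aNext (V v))) (setn vn (NAdd (V vn) oneN))).

(** The end marker [N] exceeds every index, so the comparison of the two cursors also picks the
    right list when the other one is exhausted. Only the cursors move; the lists survive, and that
    of [yval] is reused for each class. *)
Definition merge_cmd :=
  Seq (setn vla (NGet aHead getyval))
  (Seq (setn vlb (NGet aHead (V vc)))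
  (Seq (setn vn (NConst 0))
  (While (BNot (BAnd (BNLe getN (V vla)) (BNLe getN (V vlb))))
    (If (BNLe (V vla) (V vlb)) (take_cmd vla) (take_cmd vlb))))).

(* [l] is stored as a linked list with first cell [h], [N] being the end marker. *)
Fixpoint chain (next : nat -> nat) (N h : nat) (l : seq nat) : Prop :=
  if l is x :: l' then h = x /\ chain next N (next x) l' else h = N.

Lemma eq_chain next next' N h l : {in l, next =1 next'} ->
  chain next N h l -> chain next' N h l.
Proof.
elim: l h => //= x l IH h E [-> cl]; split=> //; rewrite -E ?mem_head //.
by apply: IH cl => z zl; apply: E; rewrite inE zl orbT.
Qed.

Lemma wp_take s v nx N l x k : nat_mem s vn 0 = k -> nat_mem s v 0 = x ->
  chain nx N x (x :: l) -> (forall j, nat_mem s aNext j = nx j) -> v \in [:: vla; vlb] ->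
  wp (take_cmd v) s 1 (fun s' => [/\ nat_mem s' vn 0 = k.+1,
    chain nx N (nat_mem s' v 0) l,
    forall v', v' \in [:: vla; vlb] -> v' != v -> nat_mem s' v' 0 = nat_mem s v' 0 &
    [seq nat_mem s' aPoint j | j <- iota 0 k.+1] =
    rcons [seq nat_mem s aPoint j | j <- iota 0 k] x]).
Proof.
move=> ns vs [_ cl] sn; rewrite !inE => vv.
have hv : [/\ (v == aPoint) = false, (aPoint == v) = false,
    (v == vn) = false & (vn == v) = false] by case/orP: vv => /eqP ->.
case: hv => h1 h2 h3 h4.
have key (s' : state) :
    (forall j, nat_mem s' aPoint j = if j == k then x else nat_mem s aPoint j) ->
    [seq nat_mem s' aPoint j | j <- iota 0 k.+1] =
    rcons [seq nat_mem s aPoint j | j <- iota 0 k] x.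
  move=> H; rewrite -[k.+1]addn1 iotaD map_cat /= add0n cats1 H eqxx; congr rcons.
  apply/eq_in_map => j; rewrite mem_iota => /andP[_ jk]; rewrite H.
  by rewrite (ltn_eqF jk).
apply: wp_seq => //; apply: wp_nset => //.
apply: wp_seq => //; apply: wp_nset => //; apply: wp_nset => //.
split; last by apply: key => j; rewrite /= /store /= h2 ns vs.
- by rewrite /= /store /= h4 ns addn1.
- by rewrite /= /store /= h3 h1 !eqxx /= vs sn.
move=> v'; rewrite !inE => vv' nv; rewrite /= /store /= (negbTE nv).
by case/orP: vv' => /eqP ->.
Qed.

Lemma wp_merge s N la lb : nat_mem s 0 0 = N ->
  chain (nat_mem s aNext) N (nat_mem s aHead (nat_mem s 0 4)) la ->
  chain (nat_mem s aNext) N (nat_mem s aHead (nat_mem s vc 0)) lb ->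
  all (gtn N) la -> all (gtn N) lb ->
  let n := (size la + size lb)%N in
  wp merge_cmd s n.+1 (fun s' => nat_mem s' vn 0 = n /\
    [seq nat_mem s' aPoint j | j <- iota 0 n] = merge leq la lb).
Proof.
move=> sN ca cb aa ab n.
apply: wp_seq => //; apply: wp_nset => //=; apply: wp_seq => //; apply: wp_nset => //=.
apply: wp_seq => //; apply: wp_nset => //=; set s0 := nset _ _ _ _.
rewrite -[n.+1]muln1.
(* The output so far followed by the merge of the remaining lists is always the full merge; the
   number of rounds equals the number of points written. *)
apply: (@wp_while _ _ _ _ _ (fun k s' => exists la' lb',
  [/\ chain (nat_mem s aNext) N (nat_mem s' vla 0) la',
      chain (nat_mem s aNext) N (nat_mem s' vlb 0) lb',
      all (gtn N) la' && all (gtn N) lb' &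
      [/\ nat_mem s' vn 0 = k, (k + (size la' + size lb') = n)%N &
      [seq nat_mem s' aPoint j | j <- iota 0 k] ++ merge leq la' lb' = merge leq la lb]])) => //.
- by exists la, lb; split=> //=; rewrite ?aa ?ab.
- move=> k s' a [la' [lb' [ca' cb' /andP[aa' ab'] [ns' sz E]]]] bs.
  have sN' : nat_mem s' 0 0 = N by rewrite a.1.
  have sn' j : nat_mem s' aNext j = nat_mem s aNext j by rewrite a.1.
  rewrite /= sN' in bs.
  have kn : (k < n)%N.
    rewrite -sz -addn1 leq_add2l; case: (la') (lb') ca' cb' bs => [|//] [|//] /= -> ->.
    by rewrite leqnn.
  split=> //; apply: wp_if => // ab_le; rewrite /= in ab_le.
    case: la' ca' aa' E sz => [|x la'] ca' aa' E sz.
      (* If the first list were exhausted, its cursor would be [N], and the comparison would put the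
         second cursor at [N] or beyond, against the loop test. *)
      move: bs ab_le; rewrite -ca' => bs ab_le; exfalso.
      by move: bs ab_le; rewrite ca' leqnn /= => /negP.
    have vx : nat_mem s' vla 0 = x by case: ca'.
    have cx : chain (nat_mem s aNext) N x (x :: la') by rewrite vx in ca'.
    apply: (wp_conseq (wp_take ns' vx cx sn' (mem_head _ _))) =>
      [//|s2 a2 [n2 c2 o2 p2]]; exists la', lb'; split=> //.
    + by rewrite (o2 vlb).
    + by move: aa' => /= /andP[_ ->].
    split=> //; first by rewrite -sz /=; lia.
    rewrite p2 -E cat_rcons; congr (_ ++ _).
    case: lb' {E sz} cb' ab' => [|z lb'] cb' ab' /=; first by case: (la').
    by case: cb' => zE _; rewrite -zE -vx ab_le.
  case: lb' cb' ab' E sz => [|z lb'] cb' ab' E sz.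
    exfalso; move: ab_le; rewrite cb'; case: la' ca' aa' {E sz} => [->|x la' [-> _]] /=.
      by rewrite leqnn.
    by move=> /andP[xN _]; rewrite ltnW.
  have vz : nat_mem s' vlb 0 = z by case: cb'.
  have cz : chain (nat_mem s aNext) N z (z :: lb') by rewrite vz in cb'.
  apply: (wp_conseq (wp_take (v := vlb) ns' vz cz sn' isT)) =>
      [//|s2 a2 [n2 c2 o2 p2]]; exists la', lb'; split=> //.
  + by rewrite (o2 vla).
  + by move: ab' => /= /andP[_ ->]; rewrite aa'.
  split=> //; first by rewrite -sz /=; lia.
  rewrite p2 -E cat_rcons; congr (_ ++ _).
  case: la' {E sz} ca' aa' => [|x la'] ca' aa' //=.
  by case: ca' => xE _; rewrite -xE -vz (negbTE ab_le).
move=> k s' a [la' [lb' [ca' cb' /andP[aa' ab'] [ns' sz E]]]] /=.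
have sN' : nat_mem s' 0 0 = N by rewrite a.1.
rewrite sN' negbK => /andP[Na Nb].
have la0 : la' = [::].
  by case: (la') ca' aa' => [//|x l] [xE _] /= /andP[xN _]; rewrite xE in Na; lia.
have lb0 : lb' = [::].
  by case: (lb') cb' ab' => [//|x l] [xE _] /= /andP[xN _]; rewrite xE in Nb; lia.
by move: sz E; rewrite la0 lb0 /= !addn0 cats0 ns' => -> ->.
Qed.

Lemma merge_filter_iota (P Q : pred nat) N : (forall j, P j -> Q j -> False) ->
  merge leq [seq j <- iota 0 N | P j] [seq j <- iota 0 N | Q j] =
  [seq j <- iota 0 N | P j || Q j].
Proof.
move=> PQ; have srt R : sorted leq [seq j <- iota 0 N | R j].
  by apply: (sorted_filter leq_trans); apply: iota_sorted.
apply: (sorted_eq leq_trans anti_leq) => //.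
  by apply: merge_sorted => //; exact: leq_total.
rewrite perm_merge; apply: uniq_perm.
- rewrite cat_uniq !filter_uniq ?iota_uniq //= andbT; apply/hasPn => j.
  by rewrite !mem_filter => /andP[Qj _]; apply/negP => /andP[Pj _]; apply: PQ Qj.
- by rewrite filter_uniq ?iota_uniq.
by move=> j; rewrite mem_cat !mem_filter andb_orl.
Qed.

(** * The contribution of one class to all outputs *)

Definition class_cmd := Seq merge_cmd (For vi (V vn) point_cmd).

Section ClassCorrectness.
Variables (N C K : nat) (y : 'I_N -> 'I_C) (yval : 'I_C) (w : 'I_N -> rat).
Variables (W1 Wd : nat) (r : 'I_N -> nat).
Hypotheses (K0 : (0 < K)%N) (W10 : (0 < W1)%N).
Hypotheses (rW1 : forall i, (r i <= W1)%N) (wr : forall i, w i = (r i)%:R / W1%:R).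
Hypothesis KWd : (K * (2 * W1) < Wd)%N.
Variable x0 : 'I_N.

Definition label (j : nat) : nat := nth 0%N [seq nat_of_ord (y i) | i <- enum 'I_N] j.

Lemma labelE (i : 'I_N) : label i = y i.
Proof.
by rewrite /label (nth_map x0) ?size_enum_ord // nth_ord_enum.
Qed.

Definition bucket (c k m : nat) : seq nat := [seq j <- iota k m | label j == c].

Record globals (s : state) : Prop := Globals {
  gloN : nat_mem s 0 0 = N;
  gloC : nat_mem s 0 1 = C;
  gloK : nat_mem s 0 2 = K;
  gloyval : nat_mem s 0 4 = yval;
  gloW1 : nat_mem s vW1 0 = W1;
  gloWd : nat_mem s vWd 0 = Wd;
  gloL : nat_mem s vL 0 = (K * Wd)%N;
  gloKW1 : nat_mem s vKW1 0 = (K * W1)%N;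
  gloVote : forall i : 'I_N, nat_mem s aVote i = shifted_vote y yval W1 r i;
  gloHead : forall c, (c < C)%N ->
    chain (nat_mem s aNext) N (nat_mem s aHead c) (bucket c 0 N) }.

Lemma globals_agree ns qs s s' : agree ns qs s s' ->
  all (fun a => a \notin ns) [:: 0; aVote; aHead; aNext; vW1; vWd; vL; vKW1]%N ->
  globals s -> globals s'.
Proof.
move=> [a _] /= /and5P[h0 h1 h2 h3 /and5P[h4 h5 h6 h7 _]] [*].
split; rewrite ?a //; first by move=> j; rewrite a.
move=> c cC; rewrite a //.
by apply: (@eq_chain (nat_mem s aNext)) => [z _|]; [rewrite a|auto].
Qed.

Variable c : 'I_C.
Hypothesis c_yval : c != yval.
Let D := relevant y yval c.

Lemma val_enum_relevant : map val (enum D) = merge leq (bucket yval 0 N) (bucket c 0 N).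
Proof.
rewrite merge_filter_iota; last first.
  by move=> j /eqP -> /eqP E; case/eqP: c_yval; apply: val_inj.
have -> : enum D = [seq i <- enum 'I_N | i \in D] by rewrite enumT.
rewrite -val_enum_ord filter_map; congr map; apply: eq_filter => i.
by rewrite inE /= labelE.
Qed.

Lemma wp_class s : globals s -> nat_mem s vc 0 = c ->
  wp class_cmd s (#|D|.+1 * (#|D|.+1 * (4 * (K * Wd)))) (fun s' => forall i : 'I_N,
    rat_mem s' qOut i = rat_mem s qOut i +
      shapley (class_utility K y yval w c) i / (C%:R - 1)).
Proof.
move=> gs cs; set n := #|D|; set X := (n.+1 * (4 * (K * Wd)))%N.
have Wd0 : (0 < Wd)%N by apply: leq_ltn_trans KWd.
have X0 : (0 < X)%N by rewrite /X !muln_gt0 K0 Wd0.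
have sz : (size (bucket yval 0 N) + size (bucket c 0 N) = n)%N.
  by rewrite /n cardE -(size_map val) val_enum_relevant size_merge size_cat.
have bN k : all (gtn N) (bucket k 0 N).
  by apply/allP => z; rewrite mem_filter mem_iota => /and3P[].
apply: wp_seq; first by rewrite muln_gt0.
apply: (wp_conseq (@wp_merge s N (bucket yval 0 N) (bucket c 0 N) _ _ _ _ _)) => //.
- exact: gloN gs.
- by rewrite (gloyval gs); apply: (gloHead gs).
- by rewrite cs; apply: (gloHead gs).
- by rewrite sz leq_pmulr.
rewrite sz -val_enum_relevant => s1 a1 [n1 p1].
have gs1 := globals_agree a1 isT gs.
pose e j := nth x0 (enum D) j.
have szD : size (enum D) = n by rewrite -cardE.
have pE j : (j < n)%N -> nat_mem s1 aPoint j = e j.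
  move=> jn; have := congr1 (fun l => nth 0%N l j) p1.
  rewrite (nth_map 0%N) ?size_iota // nth_iota // add0n => ->.
  by rewrite (nth_map x0) ?szD.
have cs1 : ctx K W1 Wd n (fun j => shifted_vote y yval W1 r (e j)) s1.
  case: gs1 => *; split=> // j jn; rewrite pE //.
pose S (i : 'I_N) : rat := shapley (class_utility K y yval w c) i / (C%:R - 1).
have o1 j : rat_mem s1 qOut j = rat_mem s qOut j by rewrite a1.2.
(* A point outside [D] has index [#|D|] in the enumeration, so it never receives a share; its share
   is 0 by [shapley_irrelevant]. *)
apply: (@wp_for _ _ _ _ _ _ (fun k s' => forall i : 'I_N, rat_mem s' qOut i =
   rat_mem s qOut i + if (index i (enum D) < k)%N then S i else 0)) => //.
- by move=> s' a; rewrite /= a.1.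
- by move=> i /=; rewrite o1 addr0.
- move=> k s2 a2 kn ks I.
  have cs2 := ctx_agree a2 isT cs1.
  apply: wp_conseq (wp_point K0 Wd0 cs2 ks kn) _ _ => // s3 a3 O3 i /=.
  rewrite O3 I -addrA (a2.1 aPoint) // (a2.1 0%N) // pE // (gloC gs1); congr (_ + _).
  rewrite -(shapley_class_value c_yval K0 W10 rW1 wr KWd x0) // -/(e k).
  rewrite ltnS [in RHS]leq_eqVlt -[_ == _ :> nat]/(i == e k).
  case: (eqVneq i (e k)) => [->|ni].
    by rewrite index_uniq ?enum_uniq ?szD // ltnn eqxx add0r.
  case: (eqVneq (index i (enum D)) k) => [E|_]; last by rewrite addr0.
  by case/eqP: ni; rewrite /e -E nth_index // -index_mem szD E.
move=> s' a O i; rewrite O; congr (_ + _); rewrite -szD index_mem mem_enum.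
case: ifPn => // iD; by rewrite /S (shapley_irrelevant K c_yval W10 rW1 wr) ?mul0r.
Qed.
End ClassCorrectness.

(** * Preparation of the parameters, the integer votes and the lists by label *)

Definition width_cmd :=
  Seq (setn vW oneN)
  (Seq (For vk getb (setn vW (NAdd (V vW) (V vW))))
  (Seq (setn vW1 (NSub (V vW) oneN))
  (Seq (setn vWd (NConst 0))
  (Seq (setn vKW1 (NConst 0))
  (Seq (For vk getK (Seq (setn vWd (NAdd (V vWd) (NAdd (V vW) (V vW))))
                         (setn vKW1 (NAdd (V vKW1) (V vW1)))))
  (Seq (setn vL (NConst 0))
       (For vk getK (setn vL (NAdd (V vL) (V vWd)))))))))).

Definition heads_cmd := For vk getC (NSet aHead (V vk) getN).

(* A weight can only be compared with naturals, not rounded to one: its numerator is found by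
   linear search. *)
Definition link_body :=
  let lab := NGet aLabel (V vi) in
  Seq (setn vi (NSub (NSub getN oneN) (V vk)))
  (Seq (NSet aNext (V vi) (NGet aHead lab))
  (Seq (NSet aHead lab (V vi))
  (Seq (setn vr (NConst 0))
  (Seq (While (BNot (BQLe (QMul (QGet qWeight (V vi)) (QNat (V vW1))) (QNat (V vr))))
          (setn vr (NAdd (V vr) oneN)))
  (If (BAnd (BNLe lab getyval) (BNLe getyval lab))
      (NSet aVote (V vi) (NAdd (V vW1) (V vr)))
      (NSet aVote (V vi) (NSub (V vW1) (V vr)))))))).

(** Points are pushed onto the lists from the last to the first, which makes each list increasing,
    as merging needs. *)
Definition link_cmd := For vk getN link_body.

Definition main_cmd :=
  Seq width_cmd (Seq heads_cmd (Seq link_cmd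
    (For vc getC (If (BAnd (BNLe (V vc) getyval) (BNLe getyval (V vc))) Skip class_cmd)))).

Section SetupCorrectness.
Variables (N C K b : nat) (y : 'I_N -> 'I_C) (yval : 'I_C) (w : 'I_N -> rat).
Variable r : 'I_N -> nat.
Local Notation W1 := (2 ^ b - 1)%N.
Local Notation Wd := (K * (2 * 2 ^ b))%N.

Lemma wp_width s X : nat_mem s 0 2 = K -> nat_mem s 0 3 = b -> (b < X)%N -> (K < X)%N ->
  wp width_cmd s X (fun s' => [/\ nat_mem s' vW1 0 = W1, nat_mem s' vWd 0 = Wd,
    nat_mem s' vKW1 0 = (K * W1)%N & nat_mem s' vL 0 = (K * Wd)%N]).
Proof.
move=> sK sb bX KX; have X0 : (0 < X)%N by apply: leq_trans KX.
apply: wp_seq => //; apply: wp_nset => //=; set s0 := nset _ _ _ _.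
apply: wp_seq => //; apply: (wp_conseq (X := b.+1 * 1)
  (Q := fun s' => nat_mem s' vW 0 = (2 ^ b)%N)) => [||s1 a1 W1E].
- apply: (@wp_for _ _ _ _ _ _ (fun k s' => nat_mem s' vW 0 = (2 ^ k)%N)) => //.
  + by move=> s' a; rewrite /= a.1 // sb.
  by move=> k s' a kb ks I; apply: wp_nset => //=; rewrite /store /= I expnS mul2n addnn.
- by rewrite muln1.
have sK1 : nat_mem s1 0 2 = K by rewrite a1.1.
apply: wp_seq => //; apply: wp_nset => //=; apply: wp_seq => //; apply: wp_nset => //=.
apply: wp_seq => //; apply: wp_nset => //=; set s2 := nset _ _ _ _.
apply: wp_seq => //; apply: (wp_conseq (X := K.+1 * 1)
  (Q := fun s' => nat_mem s' vWd 0 = Wd /\ nat_mem s' vKW1 0 = (K * W1)%N)) => [||s3 a3 [WdE KW1E]].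
- apply: (@wp_for _ _ _ _ _ _ (fun k s' => nat_mem s' vWd 0 = (k * (2 * 2 ^ b))%N /\
    nat_mem s' vKW1 0 = (k * W1)%N)) => //.
  + by move=> s' a; rewrite /= a.1 // /s2 /= /store.
  move=> k s' a kK ks [I1 I2]; apply: wp_seq => //; apply: wp_nset => //=; apply: wp_nset => //=.
  rewrite /store /= I1 I2 (a.1 vW) // (a.1 vW1) // /s2 /= /store /= W1E; lia.
- by rewrite muln1.
have sK3 : nat_mem s3 0 2 = K by rewrite a3.1.
have W3 : nat_mem s3 vW1 0 = W1 by rewrite a3.1 //= /store /= W1E.
apply: wp_seq => //; apply: wp_nset => //=; set s4 := nset _ _ _ _.
apply: (wp_conseq (X := K.+1 * 1) (Q := fun s' => nat_mem s' vL 0 = (K * Wd)%N)) => [||s5 a5 LE].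
- apply: (@wp_for _ _ _ _ _ _ (fun k s' => nat_mem s' vL 0 = (k * Wd)%N)) => //.
  + by move=> s' a; rewrite /= a.1.
  move=> k s' a kK ks I; apply: wp_nset => //=.
  by rewrite /store /= I (a.1 vWd) // /s4 /= /store /= WdE mulSn addnC.
- by rewrite muln1.
by split=> //; rewrite a5.1.
Qed.

Lemma wp_heads s X : nat_mem s 0 0 = N -> nat_mem s 0 1 = C -> (C < X)%N ->
  wp heads_cmd s X (fun s' => forall c, (c < C)%N -> nat_mem s' aHead c = N).
Proof.
move=> sN sC CX; apply: (wp_conseq (X := C.+1 * 1)) => [|//|s' _]; last 2 first.
- by rewrite muln1.
- exact.
apply: (@wp_for _ _ _ _ _ _ (fun k s' => forall c, (c < k)%N -> nat_mem s' aHead c = N)) => //.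
- by move=> s' a; rewrite /= a.1.
move=> k s' a kC ks I; apply: wp_nset => //= c ck; rewrite /store /= ks (a.1 0%N) // sN.
by case: eqP => // ck'; apply: I; lia.
Qed.

Hypotheses (W10 : (0 < W1)%N).
Hypotheses (rW1 : forall i, (r i <= W1)%N) (wr : forall i, w i = (r i)%:R / W1%:R).
Variable x0 : 'I_N.

Lemma wp_link s X : nat_mem s 0 0 = N -> nat_mem s 0 4 = yval -> nat_mem s vW1 0 = W1 ->
  (forall i : 'I_N, nat_mem s aLabel i = y i) ->
  (forall i : 'I_N, rat_mem s qWeight i = w i) ->
  (forall c, (c < C)%N -> nat_mem s aHead c = N) -> (N.+1 * 2 ^ b <= X)%N ->
  wp link_cmd s X (fun s' =>
    (forall i : 'I_N, nat_mem s' aVote i = shifted_vote y yval W1 r i) /\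
    (forall c, (c < C)%N -> chain (nat_mem s' aNext) N (nat_mem s' aHead c) (bucket y c 0 N))).
Proof.
move=> sN syv sW1 sy sw sh NX.
apply: (wp_conseq (X := N.+1 * 2 ^ b) (Q := fun s' =>
    (forall i : 'I_N, nat_mem s' aVote i = shifted_vote y yval W1 r i) /\
    (forall c, (c < C)%N -> chain (nat_mem s' aNext) N (nat_mem s' aHead c) (bucket y c 0 N))))
  => [|//|//].
have X0 : (0 < 2 ^ b)%N by rewrite expn_gt0.
apply: (@wp_for _ _ _ _ _ _ (fun k s' =>
    (forall i : 'I_N, (N - k <= i)%N -> nat_mem s' aVote i = shifted_vote y yval W1 r i) /\
    (forall c, (c < C)%N ->
      chain (nat_mem s' aNext) N (nat_mem s' aHead c) (bucket y c (N - k) k)))) => //.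
- by move=> s' a; rewrite /= a.1.
- split=> [[i iN] /=|c cC /=]; [lia|exact: sh].
- move=> k s1 a1 kN ks [I1 I2].
  have iN : (N - 1 - k < N)%N by lia.
  pose i := Ordinal iN.
  have sl1 : nat_mem s1 aLabel i = y i by rewrite a1.1.
  have sN1 : nat_mem s1 0 0 = N by rewrite a1.1.
  apply: wp_seq => //; apply: wp_nset => //=; rewrite sN1 ks.
  apply: wp_seq => //; apply: wp_nset => //=; rewrite /store /= -/(nat_of_ord i) sl1.
  apply: wp_seq => //; apply: wp_nset => //=; rewrite /store /= -/(nat_of_ord i) sl1.
  apply: wp_seq => //; apply: wp_nset => //=; set s2 := nset _ _ _ _.
  have is2 : nat_mem s2 vi 0 = i by [].
  have W2 : nat_mem s2 vW1 0 = W1 by rewrite /s2 /= /store /= a1.1.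
  have w2 : rat_mem s2 qWeight i * W1%:R = (r i)%:R.
    have -> : rat_mem s2 qWeight i = w i by rewrite -sw -(a1.2 qWeight).
    by rewrite wr divfK // pnatr_eq0 -lt0n.
  have l2 : nat_mem s2 aLabel i = y i by rewrite /s2 /= /store /= sl1.
  have yv2 : nat_mem s2 0 4 = yval by rewrite /s2 /= /store /= a1.1.
  apply: wp_seq => //.
  (* The search stops at [r i], after at most [W1] rounds; with the last test this is [2 ^ b]. *)
  apply: (wp_conseq (X := W1.+1 * 1) (Q := fun s' => nat_mem s' vr 0 = r i)) => [||s3 a3 r3].
  + apply: (@wp_while _ _ _ _ _ (fun j s' => nat_mem s' vr 0 = j /\ (j <= r i)%N)) => //.
    * move=> j s' a [rj jr] /=; rewrite (a.1 vi) // is2 a.2 // a.1 // W2 w2 rj ler_nat -ltnNge.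
      move=> jr'; split; first exact: leq_trans (rW1 i).
      by apply: wp_nset => //=; rewrite /store /= rj addn1.
    move=> j s' a [rj jr] /=; rewrite (a.1 vi) // is2 a.2 // a.1 // W2 w2 rj ler_nat negbK => jr'.
    by apply/eqP; rewrite eqn_leq jr.
  + by rewrite muln1; lia.
  have is3 : nat_mem s3 vi 0 = i by rewrite a3.1.
  have key (s' : state) : agree [:: aVote] [::] s3 s' ->
      (forall j, nat_mem s' aVote j =
         if j == i then shifted_vote y yval W1 r i else nat_mem s3 aVote j) ->
      (forall j : 'I_N, (N - k.+1 <= j)%N -> nat_mem s' aVote j = shifted_vote y yval W1 r j) /\
      (forall c, (c < C)%N ->
        chain (nat_mem s' aNext) N (nat_mem s' aHead c) (bucket y c (N - k.+1) k.+1)).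
    move=> a V; split=> [j jk|c cC].
      rewrite V; case: eqP => [/val_inj -> //|ji].
      by rewrite a3.1 // -[LHS]/(nat_mem s1 aVote j) I1 //; move: ji; rewrite /i /=; lia.
    rewrite /bucket /=; have -> : (N - k.+1 = i)%N by rewrite /=; lia.
    have -> : i.+1 = (N - k)%N by rewrite /=; lia.
    have ch : chain (nat_mem s' aNext) N (nat_mem s1 aHead c) (bucket y c (N - k) k).
      apply: eq_chain (I2 c cC) => z; rewrite mem_filter mem_iota => /and3P[_ zk _].
      rewrite a.1 // a3.1 // /s2 /= /store /=; case: eqP => // zi; lia.
    have hE c' : nat_mem s' aHead c' =
        if c' == y i :> nat then nat_of_ord i else nat_mem s1 aHead c'.
      by rewrite a.1 // a3.1.
    rewrite hE (labelE y x0); case: (eqVneq c (y i : nat)) => [E|ne].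
      split=> //; rewrite a.1 // a3.1 //.
      have -> : nat_mem s2 aNext i = nat_mem s1 aHead c by rewrite /s2 /= /store /= eqxx E.
      exact: ch.
    exact: ch.
  apply: wp_if => //=; rewrite (a3.1 vi) // (a3.1 0%N) // (a3.1 aLabel) // is2 l2 yv2 -eqn_leq => E.
    apply: wp_nset => //; apply: key.
      exact: agree_nset.
    move=> j; rewrite /= /store /= (a3.1 vi) // is2 (a3.1 vW1) // W2 r3 /shifted_vote.
    by rewrite -[y i == yval]/(y i == yval :> nat) E.
  apply: wp_nset => //; apply: key.
    exact: agree_nset.
  move=> j; rewrite /= /store /= (a3.1 vi) // is2 (a3.1 vW1) // W2 r3 /shifted_vote.
  by rewrite -[y i == yval]/(y i == yval :> nat) (negbTE E).
move=> s' a [I1 I2]; split=> [j|c cC]; first by apply: I1; rewrite subnn.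
by have := I2 c cC; rewrite subnn.
Qed.

End SetupCorrectness.

(** * Summation over the classes and the total running time *)

Lemma shapley_utility N C K (y : 'I_N -> 'I_C) yval w i :
  shapley (utility K y yval w) i =
  \sum_(c : 'I_C | c != yval) shapley (class_utility K y yval w c) i / (C%:R - 1).
Proof.
rewrite shapleyE; under [RHS]eq_bigr => c _ do rewrite shapleyE mulr_suml.
rewrite exchange_big /=; apply: eq_bigr => S _; rewrite /utility -mulrBr -sumrB.
by rewrite mulrCA mulr_sumr mulr_sumr; apply: eq_bigr => c _; rewrite mulrC.
Qed.

(** The grid lists k / (2^b - 1) at position k, so the position of a weight is its integer
    numerator. *)
Definition numerator N (w : 'I_N -> rat) b (i : 'I_N) : nat := index (w i) (weight_grid b).

Lemma numeratorP N (w : 'I_N -> rat) b i : w i \in weight_grid b ->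
  (numerator w b i <= 2 ^ b - 1)%N /\ w i = (numerator w b i)%:R / (2 ^ b - 1)%:R.
Proof.
move=> wi; have : (numerator w b i < 2 ^ b)%N.
  by move: wi; rewrite /numerator -index_mem size_map size_iota.
move=> lt; split; first by lia.
by rewrite -{1}(nth_index 0 wi) (nth_map 0%N) ?size_iota // nth_iota.
Qed.

Lemma wp_main N C K b (y : 'I_N -> 'I_C) yval w n : (0 < N)%N -> (0 < K)%N -> (0 < b)%N ->
  (forall i, w i \in weight_grid b) ->
  (N <= C * n)%N ->
  (forall c, c != yval -> #|relevant y yval c| = n) ->
  wp main_cmd (input K b y yval w) (C.+1 * (n.+1 * (n.+1 * (4 * (K * (K * (2 * 2 ^ b)))))))
    (fun s' => forall i : 'I_N, output s' i = shapley (utility K y yval w) i).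
Proof.
move=> N0 K0 b0 wG NCn Dn; set X := (C.+1 * _)%N; set Wd := (K * (2 * 2 ^ b))%N.
pose x0 : 'I_N := Ordinal N0; pose r := numerator w b.
have rW1 i : (r i <= 2 ^ b - 1)%N by case: (numeratorP (wG i)).
have wr i : w i = (r i)%:R / (2 ^ b - 1)%:R by case: (numeratorP (wG i)).
have b2 : (b < 2 ^ b)%N by rewrite ltn_expl.
have W10 : (0 < 2 ^ b - 1)%N by lia.
(* [2 * (2 ^ b - 1)] bounds every shifted vote; with this strict inequality the sums of different
   layers cannot collide. *)
have KWd : (K * (2 * (2 ^ b - 1)) < Wd)%N by rewrite ltn_mul2l K0 /=; lia.
have Wd0 : (0 < Wd)%N by apply: leq_ltn_trans KWd.
have bWd : (2 ^ b <= Wd)%N by rewrite /Wd mulnA leq_pmull // muln_gt0 K0.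
have Z0 : (2 ^ b <= n.+1 * (4 * (K * Wd)))%N.
  have gen A : (A <= n.+1 * (4 * (K * A)))%N by rewrite !mulnA leq_pmull // !muln_gt0 K0.
  exact: leq_trans bWd (gen _).
have Y0 : (0 < n.+1 * (n.+1 * (4 * (K * Wd))))%N.
  have gen A : (0 < A)%N -> (0 < n.+1 * (n.+1 * (4 * (K * A))))%N.
    by move=> A0; rewrite !muln_gt0 K0 A0.
  exact: gen.
have X0 : (0 < X)%N by rewrite /X muln_gt0 Y0.
(* The searches for the numerators fit into the budget thanks to [N <= C * n]. *)
have NX : (N.+1 * 2 ^ b <= X)%N.
  by rewrite /X mulnA leq_mul // mulSn mulnS; lia.
have bX : (b < X)%N by apply: leq_trans NX; rewrite (leq_trans b2) // leq_pmull.
have KX : (K < X)%N.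
  have KZ : (K <= K * Wd)%N by rewrite leq_pmulr.
  rewrite /X; set A := (n.+1 * (4 * _))%N.
  have AK : (4 * K <= A)%N by rewrite /A (leq_trans _ (leq_pmull _ _)) // leq_mul2l KZ.
  by apply: (@leq_trans A); [lia|rewrite mulnA leq_pmull].
have CX : (C < X)%N by rewrite /X leq_pmulr.
set s0 := input K b y yval w.
have lab0 (i : 'I_N) : nat_mem s0 aLabel i = y i by exact: labelE x0 i.
have w0 (i : 'I_N) : rat_mem s0 qWeight i = w i.
  by rewrite /= /load /= (nth_map x0) ?size_enum_ord // nth_ord_enum.
have o0 j : rat_mem s0 qOut j = 0 by rewrite /= /load /= nth_nil.
apply: wp_seq => //.
have hw := @wp_width K b s0 X erefl erefl bX KX.
apply: (wp_conseq hw) => [//|s1 a1 [s1W1 s1Wd s1KW1 s1L]].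
apply: wp_seq => //.
have s1N : nat_mem s1 0 0 = N by rewrite a1.1.
have s1C : nat_mem s1 0 1 = C by rewrite a1.1.
apply: wp_conseq (wp_heads s1N s1C CX) _ _ => // s2 a2 H2.
apply: wp_seq => //.
have a12 i j : i \notin [:: vW; vk; vW1; vWd; vKW1; vL; aHead] -> nat_mem s2 i j = nat_mem s0 i j.
  by move=> hi; rewrite a2.1 ?a1.1 //; apply: contra hi; apply: allP.
have q12 i j : rat_mem s2 i j = rat_mem s0 i j by rewrite a2.2 // a1.2.
have s2W1 : nat_mem s2 vW1 0 = (2 ^ b - 1)%N by rewrite a2.1.
apply: (wp_conseq (@wp_link N C b y yval w r W10 rW1 wr x0 s2 X _ _ _ _ _ _ _)) => //.
- by rewrite a12.
- by rewrite a12.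
- by move=> i; rewrite a12.
- by move=> i; rewrite q12.
move=> s3 a3 [V3 H3].
have g3 : globals K y yval (2 ^ b - 1) Wd r s3.
  by split=> //; rewrite a3.1 //; first [by rewrite a12 | by rewrite a2.1].
have o3 j : rat_mem s3 qOut j = 0 by rewrite a3.2 // q12.
pose S (c : 'I_C) (i : 'I_N) : rat := shapley (class_utility K y yval w c) i / (C%:R - 1).
apply: (@wp_for _ _ _ _ _ _ (fun k s' => forall i : 'I_N,
   rat_mem s' qOut i = \sum_(c : 'I_C | (c < k)%N && (c != yval)) S c i)) => //.
- by move=> s' a; rewrite /= a.1 // (gloC g3).
- by move=> i; rewrite /= o3 big_pred0.
- move=> k s4 a4 kC ks I; have g4 := globals_agree a4 isT g3.
  pose c := Ordinal kC.
  have cE (i : 'I_N) : \sum_(c : 'I_C | (c < k.+1)%N && (c != yval)) S c i =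
      \sum_(c : 'I_C | (c < k)%N && (c != yval)) S c i + if c != yval then S c i else 0.
    case: ifPn => cy; last first.
      rewrite addr0; apply: eq_bigl => c'; rewrite ltnS leq_eqVlt.
      case: (boolP (c' == yval)) => [|cy']; rewrite ?andbF // !andbT.
      case: eqP => //= E; have cc : c' = c by apply: val_inj.
      by rewrite cc (negbTE cy) in cy'.
    rewrite (bigD1 c) /= ?ltnSn // addrC; congr (_ + _); apply: eq_bigl => c'.
    rewrite ltnS leq_eqVlt -[c' == c]/(c' == k :> nat).
    by case: eqP => [->|_]; rewrite ?ltnn ?andbF //= andbT.
  apply: wp_if => /=; rewrite ?ks ?(gloyval g4) -?eqn_leq.
  + exact: Y0.
  + move=> E; apply: wp_skip; first exact: Y0.
    by move=> i /=; rewrite cE I -[c != yval]/(k != yval) E addr0.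
  move=> ne; have cy : c != yval by [].
  apply: wp_conseq (wp_class K0 W10 rW1 wr KWd x0 cy g4 ks) _ _ => [|s5 a5 O5 i /=].
    by rewrite Dn.
  by rewrite O5 I cE cy.
move=> s' a O i; rewrite /output O shapley_utility; apply: eq_bigl => c.
by rewrite ltn_ord.
Qed.

(** With N = C * q the target is K^2 * C * q^2 * W. Since C + 1 <= 2 * C and 2 * q + 1 <= 3 * q, the
    constant is 2 * 3 * 3 * 4 * 2 = 144. *)
Lemma running_time_bound (A t N C K q W : nat) : (0 < N)%N -> (0 < C)%N -> N = (C * q)%N ->
  (t <= A * (C.+1 * ((2 * q).+1 * ((2 * q).+1 * (4 * (K * (K * (2 * W))))))))%N ->
  t%:R <= (A * 144)%:R * ((K ^ 2 * N ^ 2 * W)%:R / C%:R) :> rat.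
Proof.
move=> N0 C0 NE tX; have q0 : (0 < q)%N by move: N0; rewrite NE muln_gt0 => /andP[].
have C0r : C%:R != 0 :> rat by rewrite pnatr_eq0 -lt0n.
have -> : (K ^ 2 * N ^ 2 * W)%:R / C%:R = (K ^ 2 * (C * q ^ 2) * W)%:R :> rat.
  by rewrite NE expnMn !natrM; field.
rewrite -natrM ler_nat; apply: leq_trans tX _; rewrite -[X in (_ <= X)%N]mulnA leq_mul2l.
apply/orP; right.
have h1 : (C.+1 <= 2 * C)%N by lia.
have h2 : ((2 * q).+1 <= 3 * q)%N by lia.
apply: leq_trans (leq_mul h1 (leq_mul h2 (leq_mul h2 (leqnn _)))) _.
by rewrite !expnS !expn0; lia.
Qed.

Theorem theorem13 :
  exists (p : cmd) (A : nat),
  forall (R : realFieldType) (X : Type) (d : X -> X -> R)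
    (N C K b : nat) (z : 'I_N -> X * 'I_C) (zval : X * 'I_C) (w : 'I_N -> rat),
  let y := fun i : 'I_N => (z i).2 in
  let yval := zval.2 in
  (0 < N)%N -> (2 <= C)%N -> (2 <= K)%N -> (1 <= b)%N ->
  (forall i j : 'I_N, (i <= j)%N ->
     d (z i).1 zval.1 <= d (z j).1 zval.1) ->
  class_balanced y ->
  (forall j : 'I_N, w j \in weight_grid b) ->
  exists (t : nat) (s : state),
    [/\ exec p (input K b y yval w) t s,
        t%:R <= A%:R * ((K ^ 2 * N ^ 2 * 2 ^ b)%:R / C%:R) :> rat
      & forall i : 'I_N, output s i = shapley (utility K y yval w) i].
Proof.
(* [csize main_cmd] is the unit in which [wp] measures time; it depends only on the fixed program
   text. *)
exists main_cmd, (csize main_cmd * 144)%N.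
move=> R X d N C K b z zval w y yval N0 C2 K2 b1 _ bal wG.
pose q := #|[set i | y i == yval]|.
have C0 : C%:R != 0 :> rat by rewrite pnatr_eq0; lia.
have NE : N = (C * q)%N.
  by apply/eqP; rewrite -(eqr_nat rat) natrM bal mulrCA divff // mulr1.
have qc c : #|[set i | y i == c]| = q by apply/eqP; rewrite -(eqr_nat rat) !bal.
have Dn c : c != yval -> #|relevant y yval c| = (2 * q)%N.
  move=> cy; rewrite -[q in RHS]/q mul2n -addnn -{2}(qc c) -cardsUI.
  rewrite [X in (_ + X)%N](_ : _ = 0%N) ?addn0; last first.
    apply/eqP; rewrite cards_eq0; apply/eqP/setP => i; rewrite !inE.
    by apply/negbTE/negP => /andP[/eqP -> /eqP E]; case/eqP: cy.
  by congr #|pred_of_set _|; apply/setP => i; rewrite !inE.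
have NCn : (N <= C * (2 * q))%N by rewrite NE leq_mul2l; lia.
have K0 : (0 < K)%N by apply: ltnW.
have [t [s [ex tX O]]] := wp_main N0 K0 b1 wG NCn Dn.
exists t, s; split; [exact: ex|exact: running_time_bound N0 (ltnW C2) NE tX|exact: O].
Qed.
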